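(* Let $n\ge 2$, let $\Omega\subset\mathbb{R}^n$ be a Lipschitz domain, and let $p,q,\mu$ be Borel measurable functions on $\Omega$ such that $1<p(x),q(x)<\infty$ for a.e. $x\in\Omega$, $m=\min\{p_-,q_-\}>1$, and $\mu\ge 0$. Then the semimodular $$\varrho(u)=\varrho_H(|\nabla u|)=\int_\Omega\left(\frac{1}{p(x)}|\nabla u|^{p(x)}+\frac{\mu(x)}{q(x)}|\nabla u|^{q(x)}\right)dx,\qquad u\in W^{1,H}(\Omega),$$ is uniformly convex.
   Context: Notation: $p_-,q_-$ are the essential infima of $p,q$ on $\Omega$. $H(x,t)=\frac{1}{p(x)}t^{p(x)}+\frac{\mu(x)}{q(x)}t^{q(x)}$ for $t\ge0$, and $\varrho_H(u)=\int_\Omega H(x,|u(x)|)\,dx$ for measurable $u$. $W^{1,H}(\Omega)$ is the space of real-valued Borel measurable functions $u$ on $\Omega$ whose first-order distributional derivatives are measurable functions and for which $\varrho_H(\lambda u)+\varrho_H(\lambda|\nabla u|)<\infty$ for some $\lambda>0$; $|\nabla u|$ is the Euclidean norm of the gradient. A convex semimodular on a vector space $V$ is a functional $\varrho:V\to[0,\infty]$ with $\varrho(0)=0$, $\varrho(\alpha u)=\varrho(u)$ if $|\alpha|=1$, and $\varrho(\alpha u+(1-\alpha)v)\le\alpha\varrho(u)+(1-\alpha)\varrho(v)$ for $\alpha\in[0,1]$. Put $V_\varrho=\{u\in V:\varrho(\lambda u)<\infty\text{ for some }\lambda>0\}$ (here $V=V_\varrho=W^{1,H}(\Omega)$). It is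 uniformly convex if for every $\varepsilon>0$ there is $\delta=\delta(\varepsilon)\in(0,1)$ such that for all $u,v\in V_\varrho$: $$\varrho\left(\tfrac{u-v}{2}\right)\ge\varepsilon\,\frac{\varrho(u)+\varrho(v)}{2}\quad\text{implies}\quad\varrho\left(\tfrac{u+v}{2}\right)\le(1-\delta)\,\frac{\varrho(u)+\varrho(v)}{2}.$$ *)

(* Defs.v *)
From HB Require Import structures.
From mathcomp Require Import all_boot all_order all_algebra lra.
From mathcomp Require Import all_classical all_reals all_analysis.
From mathcomp Require Import measurable_realfun ess_sup_inf.

Set Implicit Arguments.
Unset Strict Implicit.
Unset Printing Implicit Defensive.

Import Order.TTheory GRing.Theory Num.Theory.
Import numFieldNormedType.Exports.

Local Open Scope classical_set_scope.
Local Open Scope ring_scope.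

Section borel_rV.
Variables (R : realType) (n : nat).
Let opens : set (set 'rV[R]_n) := [set U | open U].
HB.instance Definition _ := @isMeasurable.Build (sigma_display opens)
  'rV[R]_n <<s opens >> (@sigma_algebra0 _ setT opens)
  (@sigma_algebraC _ opens) (@sigma_algebra_bigcup _ setT opens).

Lemma open_measurable_rV (U : set 'rV[R]_n) : open U -> measurable U.
Proof. exact: sub_sigma_algebra. Qed.

Lemma measurable_coord (i : 'I_n) :
  measurable_fun setT (fun v : 'rV[R]_n => v ord0 i).
Proof.
apply: (measurability _ (RGenOInfty.measurableE R)) => _ [_ [a ->] <-].
rewrite setTI; apply: open_measurable_rV.
by apply: open_comp; [move=> v _; exact: coord_continuous|exact: interval_open].
Qed.

Lemma measurable_box (A : 'I_n -> set R) : (forall i, measurable (A i)) ->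
  measurable [set v : 'rV[R]_n | forall i, A i (v ord0 i)].
Proof.
move=> mA; have -> : [set v : 'rV[R]_n | forall i, A i (v ord0 i)] =
    \bigcap_(i in setT) ((fun v : 'rV[R]_n => v ord0 i) @^-1` A i).
  by apply/seteqP; split=> [v H i _|v H i]; exact: H.
apply: fin_bigcap_measurable => // i _.
by rewrite -[X in measurable X]setTI; exact: measurable_coord.
Qed.

Let rat_ball (ck : 'rV[rat]_n * nat) : set 'rV[R]_n :=
  ball (map_mx ratr ck.1 : 'rV[R]_n) ck.2.+1%:R^-1.

Lemma open_bigcup_rat_ball (U : set 'rV[R]_n) : open U ->
  U = \bigcup_(ck in setT) (if `[< rat_ball ck `<=` U >] then rat_ball ck else set0).
Proof.
move=> oU; apply/seteqP; split=> [x Ux|x [ck _]]; last first.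
  by case: asboolP => [sub /sub|].
have /nbhs_ballP[e /= e0 eU] : nbhs x U by exact: open_nbhs_nbhs.
have [k ke] : exists k : nat, k.+1%:R^-1 < e / 2.
  have [k _ /(_ k (leqnn k))/= kP] := near_infty_natSinv_lt (PosNum (divr_gt0 e0 (ltr0n R 2))).
  by exists k.
have k0 : 0 < k.+1%:R^-1 :> R by rewrite invr_gt0.
have /boolp.choice[c cP] :
    forall i, exists q : rat, ball (x ord0 i) k.+1%:R^-1 (ratr q : R).
  move=> i.
  have /rat_in_itvoo[q] : x ord0 i - k.+1%:R^-1 < x ord0 i + k.+1%:R^-1.
    by rewrite ltrD2l gtrN.
  by rewrite in_itv/= => qx; exists q; rewrite /ball/= ltr_distlC.
exists (\row_i c i, k) => //.
have cx : ball (map_mx ratr (\row_i c i) : 'rV[R]_n) k.+1%:R^-1 x.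
  split=> // i j; rewrite !mxE ord1; apply: ball_sym; exact: cP.
rewrite asboolT// => y cy; apply: eU.
rewrite [e]splitr.
apply: (@ball_triangle _ _ (map_mx ratr (\row_i c i) : 'rV[R]_n)).
  by apply: (le_ball (ltW ke)); exact: ball_sym.
exact: (le_ball (ltW ke)).
Qed.

Lemma measurable_fun_rV d (T : measurableType d) (f : T -> 'rV[R]_n) :
  (forall i, measurable_fun setT (fun t => f t ord0 i)) -> measurable_fun setT f.
Proof.
move=> mf; apply: (measurability opens) => // _ [U oU <-]; rewrite setTI.
rewrite (open_bigcup_rat_ball oU) preimage_bigcup.
apply: countable_bigcupT_measurable => [|ck]; first exact: countableP.
case: ifPn => _; last by rewrite preimage_set0.
have -> : f @^-1` rat_ball ck = \bigcap_(i in setT)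
    ((fun t => f t ord0 i) @^-1` ball (ratr (ck.1 ord0 i) : R) ck.2.+1%:R^-1).
  apply/seteqP; split=> t /=.
    by move=> [_ H] i _; have := H ord0 i; rewrite mxE.
  by move=> H; split=> [|i j]; rewrite ?invr_gt0// ord1 mxE; exact: H.
apply: fin_bigcap_measurable => // i _.
rewrite -[X in measurable X]setTI; apply: mf => //.
exact: measurable_ball.
Qed.
End borel_rV.

Definition rV_cons (R : realType) n (xv : R * 'rV[R]_n) : 'rV[R]_n.+1 :=
  row_mx xv.1%:M xv.2.

(** The Lebesgue measure, as the iterated product of [lebesgue_measure];
    [leb_box] below gives its value on products of Borel sets. *)
Fixpoint leb (R : realType) (n : nat) : set 'rV[R]_n -> \bar R :=
  match n with
  | 0 => dirac (0 : 'rV[R]_0)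
  | n'.+1 => pushforward (lebesgue_measure \x leb (n := n'))%E (@rV_cons R n')
  end.

Section leb_theory.
Variable R : realType.

Lemma rV_cons0 n xv : @rV_cons R n xv ord0 ord0 = xv.1.
Proof.
have e : ord0 = @lshift 1 n ord0 :> 'I_(1 + n) by exact/val_inj.
transitivity (row_mx xv.1%:M xv.2 ord0 (@lshift 1 n ord0)); first by rewrite -e.
by rewrite row_mxEl mxE.
Qed.

Lemma rV_consS n xv i : @rV_cons R n xv ord0 (lift ord0 i) = xv.2 ord0 i.
Proof.
have e : lift ord0 i = @rshift 1 n i :> 'I_(1 + n) by exact/val_inj.
transitivity (row_mx xv.1%:M xv.2 ord0 (@rshift 1 n i)); first by rewrite -e.
by rewrite row_mxEr.
Qed.

Lemma measurable_rV_cons n : measurable_fun setT (@rV_cons R n).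
Proof.
apply: measurable_fun_rV => i; have [j ->|->] := unliftP ord0 i.
  have -> : (fun t => @rV_cons R n t ord0 (lift ord0 j)) =
      (fun v : 'rV[R]_n => v ord0 j) \o snd.
    by apply/funext => xv; exact: rV_consS.
  exact: measurableT_comp (@measurable_coord _ _ _) measurable_snd.
have -> : (fun t => @rV_cons R n t ord0 ord0) = fst.
  by apply/funext => xv; exact: rV_cons0.
exact: measurable_fst.
Qed.

Let leb_spec n : (exists mu : {sigma_finite_measure set 'rV[R]_n -> \bar R},
    leb (n := n) = mu :> (set 'rV[R]_n -> \bar R)) /\
  forall A : 'I_n -> set R, (forall i, measurable (A i)) ->
    leb [set v : 'rV[R]_n | forall i, A i (v ord0 i)] =
    (\prod_(i < n) lebesgue_measure (A i))%E.
Proof.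
elim: n => [|n [[mu muE] IH]].
  split; first by exists (dirac (0 : 'rV[R]_0) : {sigma_finite_measure set 'rV[R]_0 -> \bar R}).
  by move=> A mA; rewrite big_ord0 /= diracE mem_set//; case.
have box (A : 'I_n.+1 -> set R) : (forall i, measurable (A i)) ->
    leb [set v : 'rV[R]_n.+1 | forall i, A i (v ord0 i)] =
    (\prod_(i < n.+1) lebesgue_measure (A i))%E.
  move=> mA; rewrite big_ord_recl -IH//= muE /pushforward.
  rewrite -product_measure1E; [|exact: mA|]; last first.
    by apply: (@measurable_box _ _ (fun i => A (lift ord0 i))) => i; exact: mA.
  congr (product_measure1 _ _ _).
  apply/seteqP; split=> [xv H|xv [H0 H] i]; rewrite /preimage/= in H *.
    split=> [|i /=]; first by have := H ord0; rewrite rV_cons0.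
    by have := H (lift ord0 i); rewrite rV_consS.
  by have [j ->|->] := unliftP ord0 i; rewrite ?rV_cons0 ?rV_consS//; exact: H.
split => //.
pose m : {measure set 'rV[R]_n.+1 -> \bar R} :=
  measure_function_pushforward__canonical__measure_function_Measure
    (lebesgue_measure \x mu)%E (@measurable_rV_cons n).
have mE : leb (n := n.+1) = m by rewrite /= muE.
have sm : sigma_finite setT m.
  exists (fun k => [set v : 'rV[R]_n.+1 |
                    forall i, `[(- k%:R : R), k%:R]%classic (v ord0 i)]).
    apply/seteqP; split=> // v _.
    exists (Num.bound `|v|) => // i; rewrite /= in_itv/= -ler_norml.
    apply: le_trans (ltW (archi_boundP (normr_ge0 v))).
    rewrite [leRHS]/Num.norm /= mx_normrE; apply/bigmax_geP; right => /=.
    by exists (ord0, i).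
  move=> k; split.
    exact: (@measurable_box _ _ (fun=> `[(- k%:R : R), k%:R]%classic)).
  rewrite -mE (box (fun=> `[(- k%:R : R), k%:R]%classic))//.
  rewrite (eq_bigr (fun=> (k%:R - - k%:R)%:E)) => [|i _]; last first.
    rewrite lebesgue_measure_itv/= lte_fin -EFinB; case: ltP => //.
    by have := ler0n R k => k0 kN; congr _%:E; lra.
  by rewrite prodEFin ltry.
pose M : {sigma_finite_measure set 'rV[R]_n.+1 -> \bar R} :=
  HB.pack (m : set _ -> \bar R) (Measure.on m) (Measure_isSigmaFinite.Build _ _ _ m sm).
by exists M.
Qed.

Variable n : nat.

Let leb0 : @leb R n set0 = 0%E.
Proof. by case: (leb_spec n) => -[mu ->] _; exact: measure0. Qed.

Let leb_ge0 A : (0 <= @leb R n A)%E.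
Proof. by case: (leb_spec n) => -[mu ->] _; exact: measure_ge0. Qed.

Let leb_semi_sigma_additive : semi_sigma_additive (@leb R n).
Proof. by case: (leb_spec n) => -[mu ->] _; exact: measure_semi_sigma_additive. Qed.

HB.instance Definition _ := isMeasure.Build _ _ _ (@leb R n)
  leb0 leb_ge0 leb_semi_sigma_additive.

Let leb_sigma_finite : sigma_finite setT (@leb R n).
Proof. by case: (leb_spec n) => -[mu ->] _; exact: sigma_finiteT. Qed.

HB.instance Definition _ := Measure_isSigmaFinite.Build _ _ _ (@leb R n)
  leb_sigma_finite.

Lemma leb_box (A : 'I_n -> set R) : (forall i, measurable (A i)) ->
  leb [set v : 'rV[R]_n | forall i, A i (v ord0 i)] =
  (\prod_(i < n) lebesgue_measure (A i))%E.
Proof. exact: (leb_spec n).2. Qed.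

End leb_theory.
Arguments leb {R} n.

Section domains.
Variables (R : realType) (n : nat).

(* The norm of ['rV[R]_n] in the library is the sup norm. *)
Definition enorm m (v : 'rV[R]_m) : R := Num.sqrt (\sum_(i < m) v ord0 i ^+ 2).

(* Near each boundary point, in the orthonormal coordinates [y = x *m Q], the
   domain is the part above the graph [y_j = g (y_1, .., y_n without y_j)]. *)
Definition lipschitz_domain (Om : set 'rV[R]_n) : Prop :=
  [/\ Om !=set0, open Om, connected Om &
    forall x0, (closure Om `\` Om) x0 ->
    exists r : R, exists Q : 'M[R]_n, exists j : 'I_n,
    exists g : 'rV[R]_n.-1 -> R, exists L : R,
    [/\ 0 < r, Q *m Q^T = 1%:M,
        (forall a b, `|g a - g b| <= L * enorm (a - b)) &
        forall x, ball x0 r x ->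
          (Om x <-> g (col' j (x *m Q)) < (x *m Q) ord0 j)]].

Definition ess_inf_on (Om : set 'rV[R]_n) (f : 'rV[R]_n -> \bar R) : \bar R :=
  ess_inf (leb n) (patch (cst +oo%E) Om f).

End domains.

Section weak_gradient.
Variables (R : realType) (n : nat).
Implicit Types (Om K : set 'rV[R]_n) (f u phi : 'rV[R]_n -> R).

Definition partial (i : 'I_n) f : 'rV[R]_n -> R := 'D_(delta_mx ord0 i) f.

Definition partials (s : seq 'I_n) f : 'rV[R]_n -> R := foldr partial f s.

Definition smooth f : Prop := forall s : seq 'I_n,
  continuous (partials s f) /\
  forall (i : 'I_n) x, derivable (partials s f) x (delta_mx ord0 i).

Definition test_function Om phi : Prop :=
  [/\ smooth phi, compact (closure [set x | phi x != 0]) &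
      closure [set x | phi x != 0] `<=` Om].

Definition locally_integrable_rV Om f : Prop := measurable_fun Om f /\
  forall K, K `<=` Om -> compact K -> (\int[leb n]_(x in K) `|f x|%:E < +oo)%E.

(* [G] represents the distributional gradient of [u] in [Om]. *)
Definition is_weak_gradient Om u (G : 'rV[R]_n -> 'rV[R]_n) : Prop :=
  [/\ locally_integrable_rV Om u,
      forall i, locally_integrable_rV Om (fun x => G x ord0 i) &
      forall phi (i : 'I_n), test_function Om phi ->
        (\int[leb n]_(x in Om) (u x * partial i phi x)%:E =
         - \int[leb n]_(x in Om) (G x ord0 i * phi x)%:E)%E].

(* A weak gradient is unique up to a null set of [Om]; this is a choice of a
   representative (the zero field if there is no weak gradient). *)
Definition wgrad Om u : 'rV[R]_n -> 'rV[R]_n :=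
  xget (fun=> 0) [set G | is_weak_gradient Om u G].

End weak_gradient.

Section musielak_orlicz_sobolev.
Variables (R : realType) (n : nat) (Om : set 'rV[R]_n).
Variables (p q : 'rV[R]_n -> \bar R) (mu : 'rV[R]_n -> R).

Definition Hfun (x : 'rV[R]_n) (t : R) : R :=
  (fine (p x))^-1 * t `^ fine (p x) + mu x / fine (q x) * t `^ fine (q x).

Definition rhoH (u : 'rV[R]_n -> R) : \bar R :=
  (\int[leb n]_(x in Om) (Hfun x `|u x|)%:E)%E.

(* Elements are functions on the whole of R^n, whose values outside [Om] are
   irrelevant. *)
Definition W1H : set ('rV[R]_n -> R) := [set u : 'rV[R]_n -> R |
  [/\ measurable_fun Om u, exists G, is_weak_gradient Om u G &
      exists2 lam : R, 0 < lam &
        (rhoH (fun x => lam * u x)%R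
         + rhoH (fun x => lam * enorm (wgrad Om u x))%R < +oo)%E]].

Definition grad_modular (u : 'rV[R]_n -> R) : \bar R :=
  rhoH (fun x => enorm (wgrad Om u x)).

End musielak_orlicz_sobolev.

Section semimodular.
Variables (R : realType) (V : lmodType R) (W : set V) (rho : V -> \bar R).

Definition vector_subspace : Prop :=
  W 0 /\ forall (a : R) u v, W u -> W v -> W (a *: u + v).

Local Open Scope ereal_scope.

Definition convex_semimodular : Prop :=
  [/\ forall u, W u -> 0 <= rho u,
      rho 0%R = 0,
      forall (a : R) u, W u -> `|a|%R = 1%R -> rho (a *: u)%R = rho u &
      forall (a : R) u v, W u -> W v -> (0 <= a <= 1)%R ->
        rho (a *: u + (1 - a) *: v)%R <= a%:E * rho u + (1 - a)%:E * rho v].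

Definition modular_space : set V :=
  [set u | W u /\ exists2 lam : R, (0 < lam)%R & rho (lam *: u)%R < +oo].

Definition uniformly_convex : Prop :=
  forall eps : R, (0 < eps)%R -> exists delta : R, (0 < delta < 1)%R /\
    forall u v, modular_space u -> modular_space v ->
      eps%:E * (2^-1%:E * (rho u + rho v)) <= rho (2^-1 *: (u - v))%R ->
      rho (2^-1 *: (u + v))%R <= (1 - delta)%:E * (2^-1%:E * (rho u + rho v)).

End semimodular.

(* Main.v *)
(** Pointwise, [|(a+b)/2|^p + delta |(a-b)/2|^p <= (1 + delta eps) (|a|^p + |b|^p)/2]
    with [delta] depending only on [eps] and on a lower bound [m > 1] of [p]. If
    [|a-b|] is small compared to [max(|a|,|b|)] the second term is absorbed by
    [eps]; otherwise [|(a+b)/2|^m] is smaller than the mean of [|a|^m] and [|b|^m]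
    by a fixed factor, and raising this to the power [p/m >= 1] gives the same
    factor for [p]. The inequality is linear in the three powers, so it can be
    integrated against the weights [1/p] and [mu/q], and uniform convexity of the
    modular follows at once. Since the gradient of a Sobolev function is a chosen
    representative, its linearity a.e. rests on the fundamental lemma of the
    calculus of variations, proved by testing against products of the functions
    [exp(-1/x)], whose rescalings increase to the indicators of open boxes. *)

Require Import Defs.
From HB Require Import structures.
From mathcomp Require Import all_boot all_order all_algebra ring lra.
From mathcomp Require Import all_classical all_reals all_analysis.
From mathcomp Require Import measurable_realfun ess_sup_inf.

Set Implicit Arguments.
Unset Strict Implicit.
Unset Printing Implicit Defensive.

Import Order.TTheory GRing.Theory Num.Theory.
Import numFieldNormedType.Exports.

Local Open Scope classical_set_scope.
Local Open Scope ring_scope.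

(** * Uniform convexity of powers *)

Section power_inequalities.
Context {R : realType}.
Implicit Types (p m eps s t w d x y k : R).

Lemma powR_convex p t x y : 1 <= p -> 0 <= t <= 1 -> 0 <= x -> 0 <= y ->
  (t * x + (1 - t) * y) `^ p <= t * x `^ p + (1 - t) * y `^ p.
Proof.
move=> p1 /andP[t0 t1] x0 y0.
have := @convex_powR R p p1 (Itv01 t0 t1) x y.
rewrite !inE /= !in_itv /= !andbT => /(_ x0 y0).
by rewrite !convRE /=.
Qed.

Lemma powR_half p x y : 1 <= p -> 0 <= x -> 0 <= y ->
  ((x + y) / 2) `^ p <= (x `^ p + y `^ p) / 2.
Proof.
move=> p1 x0 y0; have := @powR_convex p 2^-1 x y p1 _ x0 y0.
have -> : (1 - 2^-1 : R) = 2^-1 by lra.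
rewrite -!mulrDr ![2^-1 * _]mulrC; apply; lra.
Qed.

Lemma ler_powRl p x y : 0 <= p -> 0 <= x -> x <= y -> x `^ p <= y `^ p.
Proof.
by move=> p0 x0 xy; apply: ge0_ler_powR; rewrite ?nnegrE// (le_trans x0).
Qed.

(** Strict Bernoulli inequality. Write x^m = x exp((m - 1) ln x); the strict bound exp y > 1 + y for
    y nonzero, together with x ln x >= x - 1, gives it. *)
Lemma powR_tangent_lt m x : 1 < m -> 0 < x -> x != 1 ->
  1 + m * (x - 1) < x `^ m.
Proof.
move=> m1 x0 xN1; have m0 : 0 < m by lra.
have lnx : ln x != 0 by rewrite ln_eq0.
have e1 : 1 + (m - 1) * ln x < expR ((m - 1) * ln x).
  by apply: expR_gt1Dx; rewrite mulf_neq0// subr_eq0 gt_eqF.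
have e2 : 1 - ln x <= x^-1.
  by rewrite -[in leRHS](lnK x0)// -expRN expR_ge1Dx.
have -> : x `^ m = x * expR ((m - 1) * ln x).
  by rewrite /powR gt_eqF// mulrBl mul1r expRB lnK ?posrE// mulrCA mulfV ?mulr1// gt_eqF.
have e3 : x - x * ln x <= 1.
  have := ler_wpM2l (ltW x0) e2; rewrite mulfV ?gt_eqF//; lra.
have e4 : x + x * ((m - 1) * ln x) < x * expR ((m - 1) * ln x).
  have : x * (1 + (m - 1) * ln x) < x * expR ((m - 1) * ln x) by rewrite ltr_pM2l.
  lra.
apply: le_lt_trans e4; nra.
Qed.

(** After division by the midpoint X the two points 1/X and k/X average to 1, so the linear terms of
    their strict tangent inequalities cancel; multiplying by X^m undoes the scaling. *)
Lemma powR_half_lt m k : 1 < m -> 0 < k < 1 ->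
  ((1 + k) / 2) `^ m < (1 + k `^ m) / 2.
Proof.
move=> m1 /andP[k0 k1]; set X := (1 + k) / 2.
have X0 : 0 < X by rewrite /X; lra.
have T1 : 1 + m * (1 / X - 1) < (1 / X) `^ m.
  apply: powR_tangent_lt => //; first by rewrite divr_gt0.
  by rewrite gt_eqF// ltr_pdivlMr// /X; lra.
have T2 : 1 + m * (k / X - 1) < (k / X) `^ m.
  apply: powR_tangent_lt => //; first by rewrite divr_gt0.
  by rewrite lt_eqF// ltr_pdivrMr// /X; lra.
have XE (z : R) : 0 <= z -> z `^ m = X `^ m * (z / X) `^ m.
  move=> z0; have zX : 0 <= z / X by exact: divr_ge0 (ltW X0).
  by rewrite -powRM ?(ltW X0)//; congr (_ `^ _); field; rewrite gt_eqF.
have Ek : k `^ m = X `^ m * (k / X) `^ m by apply: XE; lra.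
have E1 : 1 = X `^ m * (1 / X) `^ m by rewrite -XE// powR1.
have Xm : 0 < X `^ m by rewrite powR_gt0.
have sumX : 1 / X + k / X = 2.
  have XE2 : 1 + k = 2 * X by rewrite mulrC divfK.
  by rewrite -mulrDl XE2 mulfK// gt_eqF.
suff : 2 < (1 / X) `^ m + (k / X) `^ m.
  by rewrite -(ltr_pM2l Xm); lra.
have : m * (1 / X + k / X - 2) = 0 by rewrite sumX subrr mulr0.
lra.
Qed.

(* Karamata: (y, K, K) majorizes (k, X, X), where K and X are the midpoints of
   1 with k and y. *)
Lemma powR_gap_decreasing m k y : 1 <= m -> 0 <= y <= k -> k < 1 ->
  (1 + k `^ m) / 2 - ((1 + k) / 2) `^ m <=
  (1 + y `^ m) / 2 - ((1 + y) / 2) `^ m.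
Proof.
move=> m1 /andP[y0 yk] k1; set K := (1 + k) / 2; set X := (1 + y) / 2.
have Ky : 0 < K - y by rewrite /K; lra.
(* [al] and [be] are the weights of y when k and X are written as convex combinations of y and K.
   Since k + 2X = y + 2K, the weights satisfy al + 2 be = 1, and the two convexity bounds add up to
   the claim. *)
pose al := (K - k) / (K - y); pose be := (K - X) / (K - y).
have aK : k = al * y + (1 - al) * K by rewrite /al; field; rewrite gt_eqF.
have bK : X = be * y + (1 - be) * K by rewrite /be; field; rewrite gt_eqF.
have ab : al + 2 * be = 1.
  have sumE : K - k + 2 * (K - X) = K - y by rewrite /K /X; lra.
  by rewrite /al /be mulrA -mulrDl sumE divff// gt_eqF.
have al0 : 0 <= al by rewrite divr_ge0 ?(ltW Ky)// /K; lra.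
have be0 : 0 <= be by rewrite divr_ge0 ?(ltW Ky)// /K /X; lra.
have K0 : 0 <= K by rewrite /K; lra.
have H1 : k `^ m <= al * y `^ m + (1 - al) * K `^ m.
  by rewrite {1}aK; apply: powR_convex => //; lra.
have H2 : X `^ m <= be * y `^ m + (1 - be) * K `^ m.
  by rewrite {1}bK; apply: powR_convex => //; lra.
nra.
Qed.

(* The exponent m controls all exponents p >= m: raise the inequality for m to
   the power p / m and use the convexity of that power. *)
Lemma powR_midpoint_raise m p delta s t w : 0 < m -> m <= p ->
  0 <= delta <= 1 -> 0 <= w ->
  w `^ m <= (1 - delta) * ((s `^ m + t `^ m) / 2) ->
  w `^ p <= (1 - delta) * ((s `^ p + t `^ p) / 2).
Proof.
move=> m0 mp /andP[d0 d1] w0 H.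
have r1 : 1 <= p / m by rewrite ler_pdivlMr// mul1r.
have pE z : z `^ p = (z `^ m) `^ (p / m).
  by rewrite -powRrM mulrCA mulfV ?mulr1// gt_eqF.
rewrite !pE.
apply: le_trans (ler_powRl _ _ H) _; rewrite ?powR_ge0//; first by lra.
have A0 z z' : 0 <= (z `^ m + z' `^ m) / 2 by rewrite divr_ge0 ?addr_ge0 ?powR_ge0.
rewrite powRM//; last lra.
apply: ler_pM; rewrite ?powR_ge0//; last by apply: powR_half; rewrite ?powR_ge0.
(* What remains is (1 - delta)^(p/m) <= 1 - delta; the base 0 is treated apart. *)
have [->|dN1] := eqVneq delta 1.
  by rewrite subrr powR0// gt_eqF//; lra.
by apply: ge1r_powR => //; lra.
Qed.

(** Here s, t stand for the norms of two vectors and w, d for those of their half sum and half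
    difference. With k^2 = 1 - c^2, either t <= k s and the strict convexity gap at ratio k gives
    the factor, or t > k s and the parallelogram identity forces w <= k s. *)
Lemma midpoint_contraction m (c : R) : 1 < m -> 0 < c < 1 ->
  exists2 delta : R, 0 < delta < 1 & forall s t w d,
    0 < s -> 0 <= t <= s -> 0 <= w <= (s + t) / 2 -> c * s < d ->
    w ^+ 2 + d ^+ 2 = (s ^+ 2 + t ^+ 2) / 2 ->
    w `^ m <= (1 - delta) * ((s `^ m + t `^ m) / 2).
Proof.
move=> m1 /andP[c0 c1]; pose k := Num.sqrt (1 - c ^+ 2).
have c2 : 0 < c ^+ 2 < 1 by rewrite exprn_gt0// expr_lt1// ltW.
have k2 : k ^+ 2 = 1 - c ^+ 2 by rewrite sqr_sqrtr; lra.
have k0 : 0 < k by rewrite sqrtr_gt0; lra.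
have k1 : k < 1 by rewrite -(@ltr_pXn2r _ 2) ?nnegrE// ?(ltW k0)// k2 expr1n; lra.
have m0 : 0 <= m by lra.
pose th := k `^ m.
have one : 1 `^ m = 1 :> R by rewrite powR1.
have th0 : 0 < th by rewrite powR_gt0.
have th1 : th < 1.
  rewrite /th -[ltRHS]one; apply: gt0_ltr_powR; rewrite ?nnegrE//; lra.
pose g := (1 + th) / 2 - ((1 + k) / 2) `^ m.
have g0 : 0 < g by rewrite subr_gt0 powR_half_lt// k0.
have g1 : g < 1 by have := powR_ge0 ((1 + k) / 2) m; rewrite /g; lra.
(* [d1] solves (1 - d1) (1 + th) / 2 = th, which is what the case t > k s needs; [g] serves the case
   t <= k s. *)
pose d1 := (1 - th) / (1 + th).
have d10 : 0 < d1 by rewrite divr_gt0; lra.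
have d1E : (1 - d1) * ((1 + th) / 2) = th by rewrite /d1; field; rewrite gt_eqF//; lra.
exists (Num.min g d1); first by rewrite lt_min gt_min g0 d10 g1.
move=> s t w d s0 /andP[t0 ts] /andP[w0 wst] csd pl.
have sm : 0 < s `^ m by rewrite powR_gt0.
have dg : Num.min g d1 <= g by rewrite ge_min lexx.
have dd1 : Num.min g d1 <= d1 by rewrite ge_min lexx orbT.
set de := Num.min g d1 in dg dd1 *.
have [tks|kst] := leP t (k * s).
  pose y := t / s; have tE : t = s * y by rewrite /y mulrC divfK// gt_eqF.
  have y0 : 0 <= y by rewrite divr_ge0// ltW.
  have yk : y <= k by rewrite /y ler_pdivrMr.
  have y1 : y `^ m <= 1.
    by rewrite -[leRHS]one ler_powRl//; lra.
  have wE : w `^ m <= s `^ m * ((1 + y) / 2) `^ m.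
    rewrite -powRM//; [|lra|lra].
    by apply: ler_powRl => //; move: wst; rewrite tE; lra.
  have G := @powR_gap_decreasing m k y (ltW m1) _ k1.
  have {}G : g <= (1 + y `^ m) / 2 - ((1 + y) / 2) `^ m by apply: G; rewrite y0.
  rewrite tE powRM//; last lra.
  apply: (le_trans wE).
  (* The mean (1 + y^m) / 2 is at most 1, so [de] times it is at most the gap [g]. *)
  have : ((1 + y) / 2) `^ m <= (1 - de) * ((1 + y `^ m) / 2).
    have := powR_ge0 y m; nra.
  by move=> /(ler_wpM2l (ltW sm)); lra.
have wks : w `^ m <= th * s `^ m.
  rewrite -powRM ?(ltW s0) ?(ltW k0)//.
  apply: ler_powRl => //; rewrite -(@ler_pXn2r _ 2) ?nnegrE//; last first.
    by rewrite mulr_ge0// ltW.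
  have : t ^+ 2 <= s ^+ 2 by rewrite ler_pXn2r ?nnegrE// ltW.
  have : (c * s) ^+ 2 <= d ^+ 2.
    by rewrite ler_pXn2r ?nnegrE// ?(ltW csd)// ?mulr_ge0 ?ltW// (lt_trans _ csd)// mulr_gt0.
  rewrite !exprMn k2; nra.
have tm : th * s `^ m <= t `^ m.
  rewrite -powRM ?(ltW s0) ?(ltW k0)//; apply: ler_powRl => //; last exact: ltW.
  by rewrite mulr_ge0// ltW.
have d1lt : d1 < 1 by rewrite /d1 ltr_pdivrMr; lra.
have A1 : s `^ m * ((1 + th) / 2) <= (s `^ m + t `^ m) / 2 by nra.
have A2 : (1 - d1) * (s `^ m * ((1 + th) / 2)) <= (1 - d1) * ((s `^ m + t `^ m) / 2).
  by rewrite ler_wpM2l//; lra.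
have A3 : (1 - d1) * ((s `^ m + t `^ m) / 2) <= (1 - de) * ((s `^ m + t `^ m) / 2).
  by rewrite ler_wpM2r ?divr_ge0 ?addr_ge0 ?powR_ge0//; lra.
apply: le_trans A3; apply: le_trans A2; rewrite mulrCA d1E mulrC.
by rewrite mulrC [leRHS]mulrC.
Qed.

(* If d <= c s the term d^p is absorbed by the eps on the right; otherwise w^p
   is smaller than the mean by a factor 1 - delta. *)
Lemma powR_uniform_convexity m eps : 1 < m -> 0 < eps ->
  exists2 delta : R, 0 < delta < 1 & forall p s t w d, m <= p ->
    0 <= s -> 0 <= t -> 0 <= w <= (s + t) / 2 -> 0 <= d <= (s + t) / 2 ->
    w ^+ 2 + d ^+ 2 = (s ^+ 2 + t ^+ 2) / 2 ->
    w `^ p + delta * d `^ p <= (1 + delta * eps) * ((s `^ p + t `^ p) / 2).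
Proof.
move=> m1 eps0; pose c := Num.min eps 1 / 2.
have e0 : 0 < Num.min eps 1 by rewrite lt_min eps0/=.
have e1 : Num.min eps 1 <= 1 by rewrite ge_min lexx orbT.
have ee : Num.min eps 1 <= eps by rewrite ge_min lexx.
have cE : 2 * c = Num.min eps 1 by rewrite /c; lra.
(* With c = min(eps, 1) / 2 <= 1 and p >= 1, d <= c s implies d^p <= c s^p <= (eps / 2) s^p, which
   is at most eps times the mean of the powers. *)
have [|de /andP[de0 de1] H] := @midpoint_contraction m c m1; first by rewrite /c; lra.
exists de; first by rewrite de0.
move=> p s t w d mp; wlog ts : s t / t <= s.
  move=> W; have [/W//|/ltW st] := leP t s.
  by move=> s0 t0; rewrite (addrC s) (addrC (s `^ p)) (addrC (s ^+ 2)); exact: W.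
move=> s0 t0 /andP[w0 wst] /andP[d0 dst] pl.
have p1 : 1 <= p by lra.
have p0 : 0 <= p by lra.
have A0 : 0 <= (s `^ p + t `^ p) / 2 by rewrite divr_ge0 ?addr_ge0 ?powR_ge0.
have wA : w `^ p <= (s `^ p + t `^ p) / 2.
  by apply: le_trans (powR_half p1 s0 t0); exact: ler_powRl.
have dA : d `^ p <= (s `^ p + t `^ p) / 2.
  by apply: le_trans (powR_half p1 s0 t0); exact: ler_powRl.
have [dcs|csd] := leP d (c * s).
  have c01 : 0 < c <= 1 by rewrite /c; lra.
  have : d `^ p <= c * s `^ p.
    apply: le_trans (_ : (c * s) `^ p <= _); first exact: ler_powRl.
    by apply: ge1r_powRZ.
  have S0 := powR_ge0 s p; have T0 := powR_ge0 t p.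
  have ce : c * s `^ p <= eps * ((s `^ p + t `^ p) / 2).
    have : c * s `^ p <= eps / 2 * s `^ p by rewrite ler_wpM2r// /c; lra.
    have : 0 <= eps / 2 * t `^ p by rewrite mulr_ge0//; lra.
    lra.
  by move=> /le_trans/(_ ce)/(ler_wpM2l (ltW de0)); lra.
have sp : 0 < s.
  rewrite lt_neqAle s0 andbT eq_sym; apply: contraTneq csd => s00.
  by rewrite -leNgt; move: dst ts; rewrite s00; lra.
(* The factor 1 - de in front of the mean leaves room for de d^p, because d^p is itself at most the
   mean. *)
have : w `^ p <= (1 - de) * ((s `^ p + t `^ p) / 2).
  apply: (@powR_midpoint_raise m) => //; [lra|lra|].
  by apply: (H _ _ _ d) => //; rewrite ?t0 ?w0.
have : de * d `^ p <= de * ((s `^ p + t `^ p) / 2) by rewrite ler_pM2l.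
have : 0 <= de * eps * ((s `^ p + t `^ p) / 2) by rewrite mulr_ge0// mulr_ge0// ltW.
lra.
Qed.

End power_inequalities.

(** * Smooth functions with compact support *)

Section flat_functions.
Context {R : realType}.
Implicit Types (P Q : {poly R}) (x y : R).

(** The polynomial factor makes the family closed under differentiation; P = 1 gives the classical
    exp(-1/x). *)
Definition flat P x : R := if 0 < x then P.[x^-1] * expR (- x^-1) else 0.

Lemma horner_expRN_bound P : exists C, forall y, 0 < y ->
  `|P.[y]| * expR (- y) <= C / y.
Proof.
(* The extra power of y makes the induction on P X + c work: the factor X is absorbed by passing to
   k + 1, and the constant is bounded through y^(k+1) / (k+1)! <= exp y. *)
suff H k : exists C, forall y, 0 < y -> `|P.[y] * y ^+ k| * expR (- y) <= C / y.
  by have [C HC] := H 0%N; exists C => y /HC; rewrite expr0 mulr1.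
elim/poly_ind: P k => [k|P c IH k].
  by exists 0 => y y0; rewrite horner0 mul0r normr0 !mul0r.
have [C HC] := IH k.+1; exists (C + `|c| * (k.+1)`!%:R) => y y0.
rewrite hornerMXaddC mulrDl -mulrA -exprS mulrDl.
apply: le_trans (ler_wpM2r (expR_ge0 _) (ler_normD _ _)) _.
rewrite mulrDl lerD//; first exact: HC.
rewrite normrM -!mulrA ler_wpM2l// ger0_norm ?exprn_ge0 ?(ltW y0)//.
rewrite ler_pdivlMr// mulrAC -exprSr expRN ler_pdivrMr ?expR_gt0//.
have := expR_ge1Dxn k (ltW y0).
have k0 : 0 < (k.+1)`!%:R :> R by rewrite ltr0n fact_gt0.
move=> H; have : y ^+ k.+1 / (k.+1)`!%:R <= expR y by lra.
by rewrite ler_pdivrMr// mulrC.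
Qed.

Lemma flat_linear_bound P : exists C, forall x, `|flat P x| <= C * `|x|.
Proof.
have [C HC] := horner_expRN_bound P.
have C0 : 0 <= C.
  have := HC 1 ltr01; rewrite divr1; apply: le_trans.
  by rewrite mulr_ge0// expR_ge0.
exists C => x; rewrite /flat; case: ifPn => x0; last first.
  by rewrite normr0 mulr_ge0.
rewrite normrM (ger0_norm (expR_ge0 _)) (gtr0_norm x0).
by have := HC x^-1; rewrite invr_gt0 invrK => /(_ x0).
Qed.

Lemma flat_cvg0 P : flat P x @[x --> 0] --> 0.
Proof.
have [C HC] := flat_linear_bound P.
apply: norm_cvg0; apply: (@squeeze_cvgr _ _ _ _ (fun=> 0) (fun x => C * `|x|)).
- by apply: nearW => x; rewrite normr_ge0 HC.
- exact: cvg_cst.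
- have : C * `|x| @[x --> (0 : R)] --> C * `|0 : R|.
    by apply: cvgM; [exact: cvg_cst|exact: cvg_norm cvg_id].
  by rewrite normr0 mulr0.
Qed.

Lemma is_derive_flat P x :
  is_derive x 1 (flat P) (flat ('X^2 * (P - P^`())) x).
Proof.
have [x0|x0|->] := ltgtP x 0.
- rewrite {2}/flat ltNge (ltW x0)/=.
  apply: (@near_eq_is_derive _ _ _ (cst 0)).
  near=> y; rewrite /flat ifF// ltNge; apply/negbTE; rewrite negbK ltW//.
  by near: y; exact: lt_nbhsl.
- have xN0 : x != 0 by rewrite gt_eqF.
  apply: (@near_eq_is_derive _ _ _ (fun y => P.[y^-1] * expR (- y^-1))).
    near=> y; rewrite /flat ifT//.
    by near: y; exact: lt_nbhsr.
  have D1 : is_derive x 1 (fun y : R => y^-1) (- x ^- 2 *: 1).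
    by apply: is_deriveV => //; exact: is_derive_id.
  have D2 := is_derive1_comp (is_derive_poly P x^-1) D1.
  have D3 := @is_derive1_comp _ (@expR R) (fun y : R => - y^-1) x _ _ (is_derive_expR (- x^-1)) (is_deriveN D1).
  have D := is_deriveM D2 D3.
  apply: (is_derive_eq D).
  rewrite /flat x0 /= hornerM hornerXn hornerD hornerN /GRing.scale/= mulr1.
  rewrite -exprVn; ring.
- rewrite {2}/flat ltxx.
  (* The difference quotient at 0 is again a flat function, [flat ('X * P)], and so tends to 0. *)
  have H : h^-1 *: (flat P (h *: 1 + 0) - flat P 0) @[h --> 0^'] --> (0 : R).
    apply: cvg_trans (_ : flat ('X * P) h @[h --> 0^'] --> 0); last first.
      by apply: cvg_within_filter; exact: flat_cvg0.
    apply: near_eq_cvg; near=> h.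
    rewrite addr0 [X in flat P X]mulr1 {3}/flat ltxx subr0 /flat.
    by case: ifPn => h0; rewrite ?scaler0// hornerM hornerX -mulrA.
  apply: DeriveDef.
    by apply/cvg_ex; exists 0.
  exact: cvg_lim H.
Unshelve. all: by end_near. Qed.

End flat_functions.

(** * Smoothness of sums and products of flat functions of the coordinates *)

Section flat_algebra.
Context {R : realType} {n : nat}.
Implicit Types (P : {poly R}) (f g : 'rV[R]_n -> R) (x v : 'rV[R]_n).

Lemma is_derive_line f x v (d : R) :
  is_derive (0 : R) 1 (fun h : R => f (h *: v + x)) d -> is_derive x v f d.
Proof.
move=> [df <-]; apply: DeriveDef; first exact/derivable1P.
rewrite /derive.
set g1 := fun h => h^-1 *: _; set g2 := fun h => h^-1 *: _.
suff -> : g1 = g2 by [].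
by apply/funext => h; rewrite /g1 /g2 /= scale0r add0r addr0 [h%:A]mulr1.
Qed.

(* The algebra generated by the functions [v |-> flat P (c * v_i + d)] is
   stable under the partial derivatives. *)
Inductive flat_algebra : ('rV[R]_n -> R) -> Prop :=
| flat_algebra_cst (c : R) : flat_algebra (cst c)
| flat_algebra_flat P (i : 'I_n) (c d : R) :
    flat_algebra (fun v => flat P (c * v ord0 i + d))
| flat_algebraD f g : flat_algebra f -> flat_algebra g -> flat_algebra (f + g)
| flat_algebraM f g : flat_algebra f -> flat_algebra g -> flat_algebra (f * g).

Lemma continuous_flat P : continuous (flat P : R -> R).
Proof.
move=> x; apply/differentiable_continuous/derivable1_diffP.
by have [] := is_derive_flat P x.
Qed.

Lemma flat_algebra_continuous f : flat_algebra f -> continuous f.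
Proof.
elim=> {f} [c|P i c d|f g _ cf _ cg|f g _ cf _ cg] v.
- exact: cst_continuous.
- apply: (@continuous_comp _ _ _ (fun v : 'rV[R]_n => c * v ord0 i + d) (flat P));
    last exact: continuous_flat.
  have cM : {for v, continuous (fun v : 'rV[R]_n => c * v ord0 i)}.
    by apply: continuousM; [exact: cst_continuous|exact: coord_continuous].
  by apply: (continuousD cM); exact: cst_continuous.
- exact: (continuousD (cf v) (cg v)).
- exact: (continuousM (cf v) (cg v)).
Qed.

Lemma flat_algebra_derive f (i : 'I_n) : flat_algebra f ->
  exists2 g, flat_algebra g & forall x, is_derive x (delta_mx ord0 i) f (g x).
Proof.
elim=> {f} [c|P j c d|f1 f2 F1 [g1 G1 D1] F2 [g2 G2 D2]
           |f1 f2 F1 [g1 G1 D1] F2 [g2 G2 D2]].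
- by exists (cst 0); [exact: flat_algebra_cst|move=> x; exact: is_derive_cst].
- exists (cst (c * (j == i)%:R) *
          (fun v => flat ('X^2 * (P - P^`())) (c * v ord0 j + d))).
    exact: flat_algebraM (flat_algebra_cst _) (flat_algebra_flat _ _ _ _).
  move=> x; apply: is_derive_line.
  set k := c * (j == i)%:R; set w := c * x ord0 j + d.
  have -> : (fun h : R => flat P (c * (h *: delta_mx ord0 i + x) ord0 j + d)) =
      flat P \o (fun h : R => k * h + w).
    by apply/funext => h /=; rewrite !mxE eqxx /= /k /w; congr flat; ring.
  have D : is_derive (0 : R) 1 (fun h : R => k * h + w) k.
    have -> : (fun h : R => k * h + w) = k *: id + cst w by [].
    apply: is_derive_eq (is_deriveD (is_deriveZ k (is_derive_id _ _)) (is_derive_cst _ _ _)) _.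
    by rewrite addr0 [_ *: 1]mulr1.
  have F := is_derive_flat P (k * 0 + w).
  have DD := @is_derive1_comp _ (flat P) (fun h : R => k * h + w) 0 _ _ F D.
  apply: (is_derive_eq DD).
  by rewrite mulr0 add0r mulrC.
- exists (g1 + g2); first exact: flat_algebraD.
  by move=> x; exact: is_deriveD.
- exists (f1 * g2 + f2 * g1).
    by apply: flat_algebraD; exact: flat_algebraM.
  by move=> x; exact: is_deriveM.
Qed.

Lemma flat_algebra_partials s f : flat_algebra f -> flat_algebra (partials s f).
Proof.
move=> Ff; elim: s => //= i s Fs.
have [g Fg D] := flat_algebra_derive i Fs.
suff -> : partial i (partials s f) = g by [].
by apply/funext => x; have [_] := D x.
Qed.

Lemma flat_algebra_smooth f : flat_algebra f -> smooth f.
Proof.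
move=> Ff s; have Fs := flat_algebra_partials s Ff.
split=> [|i x]; first exact: flat_algebra_continuous.
by have [g _ /(_ x)[]] := flat_algebra_derive i Fs.
Qed.

Lemma flat_algebra_prod (I : Type) (r : seq I) (F : I -> 'rV[R]_n -> R) :
  (forall i, flat_algebra (F i)) ->
  flat_algebra (fun v => \prod_(i <- r) F i v).
Proof.
move=> FF; elim: r => [|i r IH].
  have -> : (fun v => \prod_(i <- [::]) F i v) = cst 1.
    by apply/funext => v; rewrite big_nil.
  exact: flat_algebra_cst.
have -> : (fun v => \prod_(j <- i :: r) F j v) =
    F i * (fun v => \prod_(j <- r) F j v).
  by apply/funext => v; rewrite big_cons.
exact: flat_algebraM.
Qed.

End flat_algebra.

(** * Test functions tending to the indicator of an open box *)

Section bump.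
Context {R : realType} {n : nat}.
Implicit Types (a b : 'I_n -> R) (v : 'rV[R]_n) (Om : set 'rV[R]_n).

Definition obox a b : set 'rV[R]_n := [set v | forall i, a i < v ord0 i < b i].
Definition cbox a b : set 'rV[R]_n := [set v | forall i, a i <= v ord0 i <= b i].

Lemma compact_cbox a b : compact (cbox a b).
Proof.
have -> : cbox a b = [set v | forall i, `[a i, b i]%classic (v ord0 i)].
  by apply/seteqP; split=> v H i; have := H i; rewrite /= in_itv.
apply: (@rV_compact R n (fun i => `[a i, b i]%classic)) => i.
exact: segment_compact.
Qed.

Lemma closed_cbox a b : closed (cbox a b).
Proof. by apply: compact_closed; [exact: norm_hausdorff|exact: compact_cbox]. Qed.

Lemma obox_cbox a b : obox a b `<=` cbox a b.
Proof. by move=> v H i; have /andP[/ltW -> /ltW ->] := H i. Qed.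

Lemma obox_setI a b a' b' : obox a b `&` obox a' b' =
  obox (fun i => Num.max (a i) (a' i)) (fun i => Num.min (b i) (b' i)).
Proof.
apply/seteqP; split=> [v [H H'] i|v H].
  have /andP[A B] := H i; have /andP[C D] := H' i.
  by apply/andP; rewrite gt_max lt_min; split; apply/andP.
by split=> i; have := H i; rewrite gt_max lt_min => /andP[/andP[A B] /andP[C D]];
  apply/andP.
Qed.

(** The arguments are (k+1)(t - a) and (k+1)(b - t), expanded into the affine form [c * t + d] of
    [flat_algebra_flat]. The product vanishes off the interval from a to b and tends to 1 inside it
    as k grows. *)
Definition bump_factor (a b : R) (k : nat) (t : R) : R :=
  flat 1 (k.+1%:R * t + - (k.+1%:R * a)) * flat 1 (- k.+1%:R * t + k.+1%:R * b).

Definition box_bump a b (k : nat) v : R := \prod_i bump_factor (a i) (b i) k (v ord0 i).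

Lemma flat1_itv01 (x : R) : 0 <= flat 1 x <= 1.
Proof.
rewrite /flat; case: ifPn => [x0|_]; last by rewrite lexx ler01.
by rewrite hornerC mul1r expR_ge0 expR_le1 oppr_le0 invr_ge0 ltW.
Qed.

Lemma bump_factor_itv01 (a b : R) k t : 0 <= bump_factor a b k t <= 1.
Proof.
rewrite /bump_factor; set x := _ + _; set y := _ * t + _.
have /andP[x0 x1] := flat1_itv01 x; have /andP[y0 y1] := flat1_itv01 y.
by rewrite mulr_ge0//= mulr_ile1.
Qed.

Lemma bump_itv01 a b k v : 0 <= box_bump a b k v <= 1.
Proof.
rewrite /box_bump; apply/andP; split.
  by apply: prodr_ge0 => i _; have /andP[] := bump_factor_itv01 (a i) (b i) k (v ord0 i).
by apply: prodr_ile1 => i _; exact: bump_factor_itv01.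
Qed.

Lemma bump_out a b k v : ~ obox a b v -> box_bump a b k v = 0.
Proof.
move=> /existsNP[i vi]; rewrite /box_bump (bigD1 i)//= /bump_factor.
suff -> : flat 1 (k.+1%:R * v ord0 i + - (k.+1%:R * a i)) *
    flat 1 (- k.+1%:R * v ord0 i + k.+1%:R * b i) = 0 by rewrite mul0r.
rewrite /flat mulNr [- _ + _]addrC !subr_gt0 !ltr_pM2l//.
case: ifP => av; last by rewrite mul0r.
case: ifP => vb; last by rewrite mulr0.
by case: vi; rewrite av vb.
Qed.

Lemma bump_test_function Om a b k : cbox a b `<=` Om -> test_function Om (box_bump a b k).
Proof.
move=> abOm.
have sub : closure [set x | box_bump a b k x != 0] `<=` cbox a b.
  rewrite closureE => v; apply; split; first exact: closed_cbox.
  by move=> w /= /eqP w0; apply: obox_cbox; apply: contrapT => /bump_out.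
split.
- apply: flat_algebra_smooth; apply: flat_algebra_prod => i.
  exact: flat_algebraM (flat_algebra_flat 1 i k.+1%:R _) (flat_algebra_flat 1 i (- k.+1%:R) _).
- exact: subclosed_compact (@closed_closure _ _) (@compact_cbox a b) sub.
- exact: subset_trans sub abOm.
Qed.

Lemma flat1_cvg (c : R) : 0 < c -> flat 1 (k.+1%:R * c) @[k --> \oo] --> (1 : R).
Proof.
move=> c0.
have -> : (fun k => flat 1 (k.+1%:R * c)) = expR \o (fun k : nat => - (k.+1%:R^-1 * c^-1)).
  apply/funext => k /=; rewrite /flat mulr_gt0// hornerC mul1r invfM//.
rewrite -[X in _ --> X]expR0.
apply: continuous_cvg; first exact: continuous_expR.
rewrite -oppr0 -(mul0r c^-1); apply: cvgN; apply: cvgM; last exact: cvg_cst.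
exact: cvg_harmonic.
Qed.

Lemma bump_cvg a b v : box_bump a b k v @[k --> \oo] --> (\1_(obox a b) v : R).
Proof.
rewrite indicE; have [|vab] := boolP (v \in obox a b); last first.
  have vab' : ~ obox a b v by move=> ?; move/negP: vab; apply; rewrite inE.
  by under eq_fun do rewrite bump_out//; exact: cvg_cst.
rewrite inE => vab; rewrite /box_bump.
have -> : true%:R = \prod_(i < n) (1 : R) :> R by rewrite big1.
apply: (@cvg_big R^o _ *%R 1 xpredT (@mul_continuous R) nat \oo _
  (fun i k => bump_factor (a i) (b i) k (v ord0 i)) (fun=> 1)) => i _.
have /andP[av vb] := vab i; rewrite -[X in _ --> X]mulr1.
apply: cvgM.
  under eq_fun do rewrite -mulrN -mulrDr.
  by apply: flat1_cvg; rewrite subr_gt0.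
under eq_fun do rewrite mulNr -mulrN -mulrDr addrC.
by apply: flat1_cvg; rewrite subr_gt0.
Qed.

End bump.

(** * The fundamental lemma of the calculus of variations *)

Section borel_sets_rV.
Context {R : realType} {n : nat}.
Implicit Types (a b : 'I_n -> R) (f : 'rV[R]_n -> R).

Lemma measurable_obox a b : measurable (obox a b).
Proof.
have -> : obox a b = [set v | forall i, `]a i, b i[%classic (v ord0 i)].
  by apply/seteqP; split=> v H i; have := H i; rewrite /= in_itv.
exact: (@measurable_box R n (fun i => `]a i, b i[%classic)).
Qed.

Lemma measurable_compact_rV (K : set 'rV[R]_n) : compact K -> measurable K.
Proof.
move=> cK; rewrite -[K]setCK; apply: measurableC; apply: open_measurable_rV.
by apply: closed_openC; apply: compact_closed => //; exact: norm_hausdorff.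
Qed.

Lemma continuous_measurable_rV f : continuous f -> measurable_fun setT f.
Proof.
move=> cf; apply: (measurability _ (RGenOInfty.measurableE R)) => _ [_ [a ->] <-].
rewrite setTI; apply: open_measurable_rV.
by apply: open_comp; [move=> v _; exact: cf|exact: interval_open].
Qed.

Definition oboxes : set (set 'rV[R]_n) := [set A | exists a b, A = obox a b].

Lemma setI_closed_oboxes : setI_closed oboxes.
Proof.
move=> _ _ [a [b ->]] [a' [b' ->]]; rewrite obox_setI.
by do 2!eexists.
Qed.

Lemma ball_obox (c : 'rV[R]_n) (e : R) : 0 < e ->
  ball c e = obox (fun i => c ord0 i - e) (fun i => c ord0 i + e).
Proof.
move=> e0; apply/seteqP; split=> v.
  move=> [_ H] i; have := H ord0 i; rewrite /ball /= ltr_distlC.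
  by move=> /andP[-> ->].
move=> H; split=> // i j; rewrite ord1 /ball /= ltr_distlC.
exact: H.
Qed.

(** An open set is a countable union of rational balls, and balls of the sup norm are open boxes.
    This makes the boxes a generating class, stable under intersection, for a Dynkin argument. *)
Lemma measurable_rV_oboxes : @measurable _ 'rV[R]_n = <<s oboxes >>.
Proof.
apply/seteqP; split.
  apply: smallest_sub; first exact: smallest_sigma_algebra.
  move=> U /open_bigcup_rat_ball ->.
  have -> : <<s oboxes >> = @measurable _ (g_sigma_algebraType oboxes) by [].
  apply: countable_bigcupT_measurable => [|ck]; first exact: countableP.
  case: ifPn => _; last exact: measurable0.
  apply: sub_sigma_algebra; rewrite ball_obox ?invr_gt0//.
  by do 2!eexists.
apply: smallest_sub; first exact: sigma_algebra_measurable.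
by move=> _ [a [b ->]]; exact: measurable_obox.
Qed.

End borel_sets_rV.

(** * From vanishing integrals against test functions to vanishing almost everywhere *)

Section vanishing_on_boxes.
Context {R : realType} {n : nat}.
Implicit Types (f : 'rV[R]_n -> R) (Om : set 'rV[R]_n).

Lemma integral_support d (T : measurableType d) (mu : {measure set T -> \bar R})
    (D E : set T) (g : T -> \bar R) :
  E `<=` D -> (forall x, D x -> ~ E x -> g x = 0%E) ->
  (\int[mu]_(x in D) g x = \int[mu]_(x in E) g x)%E.
Proof.
move=> ED g0; rewrite integral_mkcond [RHS]integral_mkcond.
apply: eq_integral => x _; rewrite !patchE.
case: ifPn => [/set_mem Dx|xD]; case: ifPn => [/set_mem Ex|/negP xE] //.
- by apply: g0 => // Ex; apply: xE; rewrite inE.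
- by move: xD; rewrite (mem_set (ED _ Ex)).
Qed.

Lemma locally_integrable_compact Om f (K : set 'rV[R]_n) : open Om ->
  locally_integrable_rV Om f -> compact K -> K `<=` Om ->
  (leb n).-integrable K (EFin \o f).
Proof.
move=> oOm [mf intf] cK KOm; apply/integrableP; split; last exact: intf.
apply/measurable_EFinP; apply: measurable_funS mf => //.
exact: open_measurable_rV.
Qed.

(** Dominated convergence along the bumps of the box: they lie between 0 and 1, so |f| dominates,
    and it is integrable on the compact closed box. *)
Lemma integral_obox_eq0 Om f a b : open Om -> locally_integrable_rV Om f ->
  (forall phi, test_function Om phi ->
     \int[leb n]_(x in Om) (f x * phi x)%:E = 0)%E ->
  cbox a b `<=` Om ->
  (leb n).-integrable (obox a b) (EFin \o f) /\
  (\int[leb n]_(x in obox a b) (f x)%:E = 0)%E.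
Proof.
move=> oOm lf f0 abOm; have mB := measurable_obox a b.
have BOm : obox a b `<=` Om := subset_trans (@obox_cbox _ _ _ _) abOm.
have intf : (leb n).-integrable (obox a b) (EFin \o f).
  apply: (@integrableS _ _ _ _ (cbox a b)) => //.
  - exact: measurable_compact_rV (@compact_cbox _ _ a b).
  - exact: obox_cbox.
  - exact: locally_integrable_compact oOm lf (@compact_cbox _ _ a b) abOm.
split=> //.
have mf : measurable_fun (obox a b) f by exact/measurable_EFinP/measurable_int/intf.
have mbump k : measurable_fun (obox a b) (box_bump a b k).
  apply: measurable_funTS; apply: continuous_measurable_rV.
  by have [/(_ [::])[]] := @bump_test_function R n _ a b k (@subset_refl _ (cbox a b)).
have step k : (\int[leb n]_(x in obox a b) (f x * box_bump a b k x)%:E = 0)%E.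
  rewrite -[RHS](f0 (box_bump a b k)); last exact: bump_test_function.
  apply/esym/integral_support => // x _ xB.
  by rewrite bump_out// mulr0.
have H1 k : measurable_fun (obox a b) (fun x => (f x * box_bump a b k x)%:E).
  by apply/measurable_EFinP; exact: measurable_funM.
have H3 : {ae leb n, forall x, obox a b x ->
    (f x * box_bump a b k x)%:E @[k --> \oo] --> (EFin \o f) x}.
  apply: aeW => x xB; apply: cvg_EFin; first exact: nearW.
  rewrite /= -[X in _ --> X]mulr1; apply: cvgM; first exact: cvg_cst.
  by have := @bump_cvg R n a b x; rewrite indicE mem_set.
have H5 : {ae leb n, forall x k, obox a b x ->
    (`|(f x * box_bump a b k x)%:E| <= (abse \o (EFin \o f)) x)%E}.
  apply: aeW => x k xB; rewrite lee_fin normrM ler_piMr//.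
  by have /andP[? ?] := bump_itv01 a b k x; rewrite ger0_norm.
have [_ _] := dominated_convergence mB H1 (measurable_int _ intf) H3
  (integrable_abse intf) H5.
under eq_fun do rewrite step.
by move=> /(cvg_lim _) <- //; rewrite lim_cst.
Qed.

(** The sets A for which f integrates to 0 over the part of A in the box form a Dynkin system
    containing the open boxes, hence all Borel sets; an integrable function with this property is
    null almost everywhere. *)
Lemma ae_eq0_obox f a b : (leb n).-integrable (obox a b) (EFin \o f) ->
  (forall a' b', \int[leb n]_(x in obox a b `&` obox a' b') (f x)%:E = 0)%E ->
  {ae leb n, forall x, obox a b x -> f x = 0}.
Proof.
move=> intf f0; set B := obox a b in intf f0 *.
have mB : measurable B by exact: measurable_obox.
pose P (A : set 'rV[R]_n) := (\int[leb n]_(x in B `&` A) (f x)%:E = 0)%E.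
have PA A : measurable A -> P A.
  rewrite measurable_rV_oboxes; move: A.
  apply: (dynkin_induction measurable_rV_oboxes setI_closed_oboxes).
  - by rewrite /P setIT -[B]setIid; exact: f0.
  - by move=> _ [a' [b' ->]]; exact: f0.
  - move=> S mS PS; have := f0 a b; rewrite setIid.
    have BE : B = (B `&` S) `|` (B `&` ~` S) by rewrite -setIUr setUv setIT.
    rewrite {1}BE integral_setU//; last 4 first.
    + exact: measurableI.
    + by apply: measurableI => //; exact: measurableC.
    + by rewrite -BE; exact: measurable_int intf.
    + by apply/disj_setPS; rewrite setIACA setICr setI0.
    by rewrite PS add0e.
  - move=> F mF tF PF; rewrite /P setI_bigcupr integral_bigcup//.
    + by rewrite eseries0// => k _ _; exact: PF.
    + exact: trivIset_setIl.
    + by move=> k; exact: measurableI.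
    + apply: (@integrableS _ _ _ _ B) => //.
        by apply: bigcup_measurable => k _; exact: measurableI.
      by move=> x [k _ []].
have : ae_eq (leb n) B (EFin \o f) (cst 0%E).
  apply: integral_ae_eq => // E EB mE.
  by rewrite integral_cst// mul0e; have := PA _ mE; rewrite /P setIC (setIidl EB).
by apply: filterS => x H /H[].
Qed.

(** The open set is covered by the countably many rational boxes whose closed box it contains, and f
    vanishes almost everywhere on each of them. *)
Lemma ae_eq0_test_function Om f : open Om -> locally_integrable_rV Om f ->
  (forall phi, test_function Om phi ->
     \int[leb n]_(x in Om) (f x * phi x)%:E = 0)%E ->
  {ae leb n, forall x, Om x -> f x = 0}.
Proof.
move=> oOm lf f0.
pose rbox (ab : {ffun 'I_n -> rat} * {ffun 'I_n -> rat}) : set 'rV[R]_n :=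
  obox (fun i => ratr (ab.1 i)) (fun i => ratr (ab.2 i)).
pose rcbox (ab : {ffun 'I_n -> rat} * {ffun 'I_n -> rat}) : set 'rV[R]_n :=
  cbox (fun i => ratr (ab.1 i)) (fun i => ratr (ab.2 i)).
have cover x : Om x -> exists2 ab, rcbox ab `<=` Om & rbox ab x.
  move=> Omx; have /nbhs_ballP[e /= e0 eOm] : nbhs x Om by exact: open_nbhs_nbhs.
  have /boolp.choice[p pP] : forall i : 'I_n, exists q : rat,
      x ord0 i - e < ratr q < x ord0 i.
    move=> i; have /rat_in_itvoo[q] : x ord0 i - e < x ord0 i by rewrite gtrBl.
    by rewrite in_itv/=; exists q.
  have /boolp.choice[q qP] : forall i : 'I_n, exists q : rat,
      x ord0 i < ratr q < x ord0 i + e.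
    move=> i; have /rat_in_itvoo[q] : x ord0 i < x ord0 i + e by rewrite ltrDl.
    by rewrite in_itv/=; exists q.
  exists ([ffun i => p i], [ffun i => q i]).
    move=> v vab; apply: eOm; rewrite ball_obox// => i.
    have := vab i; rewrite /= !ffunE => /andP[pv vq].
    have /andP[p1 _] := pP i; have /andP[_ q2] := qP i.
    by rewrite (lt_le_trans p1 pv) (le_lt_trans vq q2).
  move=> i; rewrite /= !ffunE; have /andP[_ ->] := pP i.
  by have /andP[-> _] := qP i.
(* The exceptional sets are indexed by [nat] through [unpickle], so that countable subadditivity
   applies; codes of no box give the empty set. *)
pose F k : set 'rV[R]_n :=
  if unpickle k is Some ab then [set x | [/\ rcbox ab `<=` Om, rbox ab x & f x <> 0]]
  else set0.
have F0 k : (leb n).-negligible (F k).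
  rewrite /F; case: unpickle => [ab|]; last exact: negligible_set0.
  have [abOm|abOm] := pselect (rcbox ab `<=` Om); last first.
    by apply: (negligibleS _ (negligible_set0 _)) => x [].
  have [intf _] := integral_obox_eq0 oOm lf f0 abOm.
  have : {ae leb n, forall x, rbox ab x -> f x = 0}.
    apply: ae_eq0_obox intf _ => a' b'; rewrite /rbox obox_setI.
    apply: (integral_obox_eq0 oOm lf f0 _).2; apply: subset_trans abOm => x xab i.
    have := xab i; rewrite ge_max le_min => /andP[/andP[xa _] /andP[xb _]].
    exact/andP.
  by apply: negligibleS => x [_ xab fx]; apply/not_implyP.
have := negligible_bigcup F0; apply: negligibleS => x /= /not_implyP[Omx fx].
have [ab abOm xab] := cover x Omx.
by exists (pickle ab) => //; rewrite /F pickleK.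
Qed.

End vanishing_on_boxes.

(** * Linearity of the weak gradient *)

Section weak_gradient_linearity.
Context {R : realType} {n : nat}.
Variable Om : set 'rV[R]_n.
Hypothesis oOm : open Om.
Implicit Types (f g u v phi : 'rV[R]_n -> R) (G H : 'rV[R]_n -> 'rV[R]_n).

Let mOm : measurable Om. Proof. exact: open_measurable_rV. Qed.

Lemma integrable_mul_compact_support f g (K : set 'rV[R]_n) :
  locally_integrable_rV Om f -> continuous g -> compact K -> K `<=` Om ->
  (forall x, ~ K x -> g x = 0) ->
  (leb n).-integrable Om (fun x => (f x * g x)%:E).
Proof.
move=> lf cg cK KOm g0.
have mK := measurable_compact_rV cK.
have intK : (leb n).-integrable K (fun x => (f x * g x)%:E).
  apply: (@integrableMl _ _ _ (leb n) K mK (EFin \o f) g).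
  - exact: (locally_integrable_compact oOm lf cK KOm).
  - by apply: measurable_funTS; exact: continuous_measurable_rV.
  - have cgK : compact (g @` K).
      by apply: continuous_compact => //; exact: continuous_subspaceT.
    have [M [Mreal HM]] := compact_bounded cgK.
    exists M; split=> // N MN x Kx.
    exact: (HM _ MN).
have -> : (fun x => (f x * g x)%:E) = (fun x => (f x * g x)%:E) \_ K.
  apply/funext => x; rewrite patchE; case: ifPn => // /negP xK.
  by rewrite g0 ?mulr0// => Kx; apply: xK; rewrite inE.
by apply/integrable_restrict => //; rewrite setIidr.
Qed.

(** Vanishing near x, and not only at x, makes the partial derivatives vanish at x too. *)
Lemma test_function_out phi x : ~ closure [set x | phi x != 0] x ->
  (\forall y \near x, phi y = 0).
Proof.
move=> xK; have : nbhs x (~` closure [set x | phi x != 0]).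
  by apply: open_nbhs_nbhs; split=> //; apply: closed_openC; exact: closed_closure.
apply: filterS => y yK; apply: contrapT => /eqP y0; apply: yK.
exact: subset_closure.
Qed.

Lemma integrable_mul_test f phi : locally_integrable_rV Om f ->
  test_function Om phi -> (leb n).-integrable Om (fun x => (f x * phi x)%:E).
Proof.
move=> lf [sphi cK KOm]; apply: (integrable_mul_compact_support lf _ cK KOm).
  by have [] := sphi [::].
by move=> x /test_function_out /nbhs_singleton.
Qed.

Lemma integrable_mul_partial_test f phi i : locally_integrable_rV Om f ->
  test_function Om phi -> (leb n).-integrable Om (fun x => (f x * partial i phi x)%:E).
Proof.
move=> lf [sphi cK KOm]; apply: (integrable_mul_compact_support lf _ cK KOm).
  by have [] := sphi [:: i].
move=> x /test_function_out x0; rewrite /partial.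
rewrite (@near_eq_derive _ _ _ phi (cst 0))//; first exact: derive_cst.
Qed.

Lemma locally_integrable_lin (a : R) f g : locally_integrable_rV Om f ->
  locally_integrable_rV Om g -> locally_integrable_rV Om (fun x => a * f x + g x).
Proof.
move=> lf lg; split.
  apply: measurable_funD lg.1; apply: measurable_funM lf.1.
  exact: measurable_cst.
move=> K KOm cK.
have intf := locally_integrable_compact oOm lf cK KOm.
have intg := locally_integrable_compact oOm lg cK KOm.
have mK := measurable_compact_rV cK.
by have /integrableP[_] := integrableD mK (integrableZl mK a intf) intg.
Qed.

Lemma is_weak_gradient_lin (a : R) u v G H : is_weak_gradient Om u G ->
  is_weak_gradient Om v H ->
  is_weak_gradient Om (a *: u + v) (fun x => a *: G x + H x).
Proof.
move=> [lu lG uG] [lv lH vH]; split.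
- exact: locally_integrable_lin.
- move=> i; rewrite (_ : (fun x => _) = (fun x => a * G x ord0 i + H x ord0 i)).
    exact: locally_integrable_lin.
  by apply/funext => x; rewrite !mxE.
- move=> phi i tphi.
  (* Applied with h a partial derivative of [phi] on the left and h = [phi] on the right. *)
  have linE f g h : locally_integrable_rV Om f -> locally_integrable_rV Om g ->
      (forall f, locally_integrable_rV Om f ->
         (leb n).-integrable Om (fun x => (f x * h x)%:E)) ->
      (\int[leb n]_(x in Om) ((a * f x + g x) * h x)%:E =
      a%:E * \int[leb n]_(x in Om) (f x * h x)%:E +
      \int[leb n]_(x in Om) (g x * h x)%:E)%E.
    move=> lf lg inth; rewrite -integralZl//; last exact: inth.
    rewrite -integralD//; [|exact/integrableZl/inth|exact: inth].
    apply: eq_integral => x _; rewrite -EFinM -EFinD; congr EFin.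
    by rewrite mulrDl mulrA.
  rewrite (linE u v (partial i phi))//; last first.
    by move=> f lf; exact: integrable_mul_partial_test.
  under [in RHS]eq_integral do rewrite !mxE.
  rewrite (linE (fun x => G x ord0 i) (fun x => H x ord0 i))//; last first.
    by move=> f lf; exact: integrable_mul_test.
  (* Finiteness allows the opposite to be distributed over a sum of extended reals. *)
  have finH : (\int[leb n]_(x in Om) (H x ord0 i * phi x)%:E)%E \is a fin_num.
    by apply: integrable_fin_num => //; exact: integrable_mul_test.
  by rewrite uG// vH// muleN [RHS]oppeD// fin_num_adde_defl.
Qed.

(** Each coordinate of G - H integrates to 0 against every test function, so the fundamental lemma
    applies; there are finitely many coordinates. *)
Lemma is_weak_gradient_unique u G H : is_weak_gradient Om u G ->
  is_weak_gradient Om u H -> {ae leb n, forall x, Om x -> G x = H x}.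
Proof.
move=> [lu lG uG] [_ lH uH].
have GH i : {ae leb n, forall x, Om x -> -1 * H x ord0 i + G x ord0 i = 0}.
  apply: (ae_eq0_test_function oOm); first exact: locally_integrable_lin.
  move=> phi tphi.
  have intG := integrable_mul_test (lG i) tphi.
  have intH := integrable_mul_test (lH i) tphi.
  under eq_integral do rewrite mulrDl mulN1r mulNr EFinD EFinN addeC.
  rewrite integralB//.
  have := uG _ i tphi; rewrite (uH _ i tphi) => /oppe_inj ->.
  by rewrite subee//; exact: integrable_fin_num.
have : {ae leb n, forall x, forall i, Om x -> -1 * H x ord0 i + G x ord0 i = 0}.
  exact: filter_forall.
apply: filterS => x xGH Omx; apply/rowP => i; have := xGH i Omx; lra.
Qed.

Definition has_weak_gradient u := exists G, is_weak_gradient Om u G.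

Lemma is_weak_gradient_wgrad u : has_weak_gradient u ->
  is_weak_gradient Om u (wgrad Om u).
Proof. by move=> uG; apply: (@xgetPex _ (fun=> 0) (is_weak_gradient Om u)). Qed.

Lemma is_weak_gradient0 : is_weak_gradient Om 0 (fun=> 0).
Proof.
have l0 : locally_integrable_rV Om (fun=> 0).
  split; first exact: measurable_cst.
  by move=> K _ _; rewrite integral0_eq// => x _; rewrite normr0.
split=> //.
  move=> i; rewrite (_ : (fun x => _) = (fun=> 0))//.
  by apply/funext => x; rewrite mxE.
move=> phi i _; rewrite !integral0_eq ?oppe0// => x _.
  by rewrite mxE mul0r.
by rewrite mul0r.
Qed.

End weak_gradient_linearity.

(** * The double phase function *)

Section euclidean_norm.
Context {R : realType} {n : nat}.
Implicit Types (u v : 'rV[R]_n) (a : R).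

Lemma sumsqr_ge0 v : 0 <= \sum_(i < n) v ord0 i ^+ 2.
Proof. by apply: sumr_ge0 => i _; exact: sqr_ge0. Qed.

Lemma enorm_ge0 v : 0 <= enorm v. Proof. exact: sqrtr_ge0. Qed.

Lemma sqr_enorm v : enorm v ^+ 2 = \sum_(i < n) v ord0 i ^+ 2.
Proof. by rewrite sqr_sqrtr// sumsqr_ge0. Qed.

Lemma enormZ a v : enorm (a *: v) = `|a| * enorm v.
Proof.
rewrite /enorm -sqrtr_sqr -sqrtrM ?sqr_ge0// mulr_sumr; congr Num.sqrt.
by apply: eq_bigr => i _; rewrite mxE exprMn.
Qed.

(** Cauchy-Schwarz: expand the sum of the squares of |v| u_i - |u| v_i and divide by |u| |v|; zero
    norms are treated apart. *)
Lemma dot_le_enorm u v : \sum_(i < n) u ord0 i * v ord0 i <= enorm u * enorm v.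
Proof.
set x := enorm u; set y := enorm v.
have x0 : 0 <= x := enorm_ge0 u; have y0 : 0 <= y := enorm_ge0 v.
have coord0 (w : 'rV[R]_n) i : enorm w = 0 -> w ord0 i = 0 :> R.
  move=> w0; have /eqP := sqr_enorm w; rewrite w0 expr0n /= eq_sym.
  rewrite psumr_eq0; last by move=> j _; exact: sqr_ge0.
  by move=> /allP/(_ i (mem_index_enum i))/=; rewrite sqrf_eq0 => /eqP.
have [xe|xN0] := eqVneq x 0.
  by rewrite xe mul0r big1// => i _; rewrite (coord0 _ _ xe) mul0r.
have [ye|yN0] := eqVneq y 0.
  by rewrite ye mulr0 big1// => i _; rewrite (coord0 _ _ ye) mulr0.
have xy : 0 < x * y by rewrite mulr_gt0// lt_neqAle eq_sym ?xN0 ?yN0.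
set g := \sum_(i < n) _.
have : 0 <= \sum_(i < n) (y * u ord0 i - x * v ord0 i) ^+ 2.
  by apply: sumr_ge0 => i _; exact: sqr_ge0.
have -> : \sum_(i < n) (y * u ord0 i - x * v ord0 i) ^+ 2 =
    y ^+ 2 * (\sum_(i < n) u ord0 i ^+ 2) +
    x ^+ 2 * (\sum_(i < n) v ord0 i ^+ 2) - 2 * (x * y) * g.
  rewrite !mulr_sumr -big_split -sumrB /=.
  by apply: eq_bigr => i _; ring.
rewrite -!sqr_enorm -/x -/y.
move=> H; rewrite -(ler_pM2l xy); lra.
Qed.

Lemma enormD u v : enorm (u + v) <= enorm u + enorm v.
Proof.
rewrite -(@ler_pXn2r _ 2) ?nnegrE ?addr_ge0 ?enorm_ge0//.
rewrite sqrrD !sqr_enorm.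
have -> : \sum_(i < n) (u + v) ord0 i ^+ 2 = \sum_(i < n) u ord0 i ^+ 2 +
    (\sum_(i < n) u ord0 i * v ord0 i) *+ 2 + \sum_(i < n) v ord0 i ^+ 2.
  rewrite -sumrMnl -!big_split /=; apply: eq_bigr => i _.
  by rewrite mxE sqrrD.
by rewrite lerD2r lerD2l lerMn2r dot_le_enorm.
Qed.

Lemma enorm_parallelogram u v :
  enorm (2^-1 *: u + 2^-1 *: v) ^+ 2 + enorm (2^-1 *: u + (- 2^-1) *: v) ^+ 2 =
  (enorm u ^+ 2 + enorm v ^+ 2) / 2.
Proof.
rewrite !sqr_enorm -!big_split mulr_suml /=; apply: eq_bigr => i _.
by rewrite !mxE; field.
Qed.

End euclidean_norm.

(** * Measurability of variable powers and removal of null sets *)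

Section measurability.
Context {R : realType} d (T : measurableType d).
Implicit Types (D : set T) (f g : T -> R).

Lemma measurable_powR2 D f g : measurable_fun D f -> measurable_fun D g ->
  measurable_fun D (fun x => f x `^ g x).
Proof.
move=> mf mg mD; move: (mD); apply: measurable_fun_if => //.
- by apply: measurable_fun_eqr => //; exact: measurable_cst.
- have -> : (fun t => (g t == 0)%:R) = (fun t => if g t == 0 then 1 else 0) :> (T -> R).
    by apply/funext => t; case: eqP.
  apply: (@measurable_funS _ _ _ _ D) => //; apply: measurable_fun_if => //.
  by apply: measurable_fun_eqr => //; exact: measurable_cst.
- apply: (@measurable_funS _ _ _ _ D) => //; apply: measurableT_comp => //.
  by apply: measurable_funM => //; apply: measurableT_comp => //; exact: measurable_ln.
Qed.

Lemma measurable_invr D f : measurable_fun D f -> measurable_fun D (fun x => (f x)^-1).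
Proof.
(* The exponent -1 gives the inverse on nonnegative bases, whence the square; at a zero of f both
   sides are 0. *)
move=> mf; have -> : (fun x => (f x)^-1) = (fun x => f x * (f x ^+ 2) `^ (-1)).
  apply/funext => x; rewrite powR_inv1 ?sqr_ge0//.
  have [->|f0] := eqVneq (f x) 0; first by rewrite invr0 mul0r.
  by rewrite expr2 invfM mulrA divff// mul1r.
apply: measurable_funM => //; apply: measurable_powR2; last exact: measurable_cst.
exact: measurable_funX.
Qed.

(** Turns an almost everywhere hypothesis into one valid at every point of a measurable subset, with
    no change in the integrals, so that integral comparisons can be made pointwise. *)
Lemma ae_measurable_subset (mu : {measure set T -> \bar R}) D (Q : T -> Prop) :
  measurable D -> {ae mu, forall x, D x -> Q x} ->
  exists E, [/\ measurable E, E `<=` D, forall x, E x -> Q x &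
    forall f : T -> \bar R, measurable_fun D f ->
      (\int[mu]_(x in D) f x = \int[mu]_(x in E) f x)%E].
Proof.
move=> mD [N [mN N0 QN]]; exists (D `\` N); split.
- exact: measurableD.
- exact: subDsetl.
- move=> x [Dx Nx]; apply: contrapT => Qx; apply: Nx; apply: QN.
  by move=> /= /(_ Dx).
- move=> f mf; rewrite setDE integral_mkcondr; apply: ae_eq_integral => //.
    apply/measurable_restrict => //; first exact: measurableC.
    by apply: measurable_funS mf => //; exact: subIsetl.
  exists N; split=> // x /= /not_implyP[Dx]; rewrite patchE.
  case: ifPn => // /negP xN _; apply: contrapT => Nx; apply: xN.
  by rewrite inE.
Qed.

End measurability.

Section double_phase_function.
Context {R : realType} {n : nat}.
Variables (p q : 'rV[R]_n -> \bar R) (mu : 'rV[R]_n -> R).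
Implicit Types (x : 'rV[R]_n) (s t w a eps : R).

Local Notation H := (Hfun p q mu).

Definition admissible (m : R) x := [/\ m <= fine (p x), m <= fine (q x) & 0 <= mu x].

Lemma Hfun_ge0 m x t : 0 <= m -> admissible m x -> 0 <= H x t.
Proof.
move=> m0 [mp mq mux]; have p0 := le_trans m0 mp; have q0 := le_trans m0 mq.
by rewrite /Hfun addr_ge0// mulr_ge0 ?powR_ge0 ?invr_ge0// divr_ge0.
Qed.

Lemma Hfun0 m x : 0 < m -> admissible m x -> H x 0 = 0.
Proof.
move=> m0 [mp mq _]; have p0 := lt_le_trans m0 mp; have q0 := lt_le_trans m0 mq.
by rewrite /Hfun !powR0 ?gt_eqF// !mulr0 addr0.
Qed.

Lemma Hfun_le m x s t : 0 <= m -> admissible m x -> 0 <= s -> s <= t -> H x s <= H x t.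
Proof.
move=> m0 [mp mq mux] s0 st; have p0 := le_trans m0 mp; have q0 := le_trans m0 mq.
by rewrite /Hfun lerD// ler_wpM2l ?invr_ge0 ?divr_ge0//; apply: ler_powRl.
Qed.

Lemma Hfun_convex m x a s t : 1 <= m -> admissible m x -> 0 <= a <= 1 ->
  0 <= s -> 0 <= t -> H x (a * s + (1 - a) * t) <= a * H x s + (1 - a) * H x t.
Proof.
move=> m1 [mp mq mux] a01 s0 t0.
have p1 := le_trans m1 mp; have q1 := le_trans m1 mq.
have ip : 0 <= (fine (p x))^-1 by rewrite invr_ge0; lra.
have iq : 0 <= mu x / fine (q x) by rewrite divr_ge0//; lra.
have := ler_wpM2l ip (powR_convex p1 a01 s0 t0).
have := ler_wpM2l iq (powR_convex q1 a01 s0 t0).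
rewrite /Hfun; lra.
Qed.

Lemma Hfun_half_le m x s t w : 1 <= m -> admissible m x -> 0 <= s -> 0 <= t ->
  0 <= w -> w <= 2^-1 * s + 2^-1 * t -> H x w <= H x s + H x t.
Proof.
move=> m1 ax s0 t0 w0 wst; have m0 : 0 <= m by lra.
apply: le_trans (Hfun_le m0 ax w0 wst) _.
have := @Hfun_convex m x 2^-1 s t m1 ax _ s0 t0.
have -> : 1 - 2^-1 = 2^-1 :> R by lra.
have := Hfun_ge0 s m0 ax; have := Hfun_ge0 t m0 ax.
have h : 0 <= (2^-1 : R) <= 1 by lra.
move=> h1 h2 h3.
by have := h3 h; lra.
Qed.

Lemma weighted_sum_le (P Q c k S1 D1 A1 B1 S2 D2 A2 B2 : R) : 0 <= P -> 0 <= Q ->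
  S1 + k * D1 <= c * ((A1 + B1) / 2) -> S2 + k * D2 <= c * ((A2 + B2) / 2) ->
  P * S1 + Q * S2 + k * (P * D1 + Q * D2) <=
  c * (2^-1 * (P * A1 + Q * A2 + (P * B1 + Q * B2))).
Proof.
move=> P0 Q0 h1 h2; have h := lerD (ler_wpM2l P0 h1) (ler_wpM2l Q0 h2).
apply: le_trans (le_trans _ h) _; rewrite le_eqVlt; apply/orP; left; apply/eqP; ring.
Qed.

(** The inequality for powers applies to the Euclidean norms: the triangle inequality bounds w and d
    by (s + t) / 2, and the parallelogram law is the required identity. *)
Lemma Hfun_uniform_convexity m eps : 1 < m -> 0 < eps ->
  exists2 delta : R, 0 < delta < 1 & forall x (u v : 'rV[R]_n), admissible m x ->
    H x (enorm (2^-1 *: u + 2^-1 *: v)) +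
    delta * H x (enorm (2^-1 *: u + (- 2^-1) *: v)) <=
    (1 + delta * eps) * (2^-1 * (H x (enorm u) + H x (enorm v))).
Proof.
move=> m1 eps0; have [de de01 Hde] := powR_uniform_convexity m1 eps0.
exists de => // x u v [mp mq mux].
have half2 : `|2^-1 : R| = 2^-1 by rewrite ger0_norm.
have nP : enorm (2^-1 *: u + 2^-1 *: v) <= (enorm u + enorm v) / 2.
  apply: le_trans (enormD _ _) _; rewrite !enormZ half2; lra.
have nM : enorm (2^-1 *: u + (- 2^-1) *: v) <= (enorm u + enorm v) / 2.
  apply: le_trans (enormD _ _) _; rewrite !enormZ normrN half2; lra.
have K e : m <= e -> enorm (2^-1 *: u + 2^-1 *: v) `^ e +
    de * enorm (2^-1 *: u + (- 2^-1) *: v) `^ e <=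
    (1 + de * eps) * ((enorm u `^ e + enorm v `^ e) / 2).
  move=> me; apply: Hde => //; rewrite ?enorm_ge0//.
  exact: enorm_parallelogram.
have ip : 0 <= (fine (p x))^-1 by rewrite invr_ge0; lra.
have iq : 0 <= mu x / fine (q x) by rewrite divr_ge0//; lra.
exact: weighted_sum_le ip iq (K _ mp) (K _ mq).
Qed.

Lemma measurable_Hfun (Om : set 'rV[R]_n) (w : 'rV[R]_n -> R) :
  measurable_fun Om p -> measurable_fun Om q -> measurable_fun Om mu ->
  measurable_fun Om w -> measurable_fun Om (fun x => (H x `|w x|)%:E).
Proof.
move=> mp mq mmu mw; apply/measurable_EFinP.
have fp : measurable_fun Om (fine \o p) by exact: measurableT_comp.
have fq : measurable_fun Om (fine \o q) by exact: measurableT_comp.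
have nw : measurable_fun Om (fun x => `|w x|) by exact: measurableT_comp.
apply: measurable_funD; apply: measurable_funM.
- exact: (measurable_invr fp).
- exact: (measurable_powR2 nw fp).
- by apply: measurable_funM => //; exact: (measurable_invr fq).
- exact: (measurable_powR2 nw fq).
Qed.

End double_phase_function.

(** * The gradient modular *)

Lemma ge0_integral_comb d (T : measurableType d) (R : realType)
    (nu : {measure set T -> \bar R}) (D : set T) (f g : T -> \bar R) (a b : R) :
  measurable D -> measurable_fun D f -> measurable_fun D g ->
  (forall x, D x -> 0 <= f x)%E -> (forall x, D x -> 0 <= g x)%E ->
  0 <= a -> 0 <= b ->
  (\int[nu]_(x in D) (a%:E * f x + b%:E * g x) =
   a%:E * \int[nu]_(x in D) f x + b%:E * \int[nu]_(x in D) g x)%E.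
Proof.
move=> mD mf mg f0 g0 a0 b0; rewrite ge0_integralD//.
- by rewrite !ge0_integralZl ?lee_fin.
- by move=> x Dx; rewrite mule_ge0 ?lee_fin// f0.
- exact: measurable_funeM.
- by move=> x Dx; rewrite mule_ge0 ?lee_fin// g0.
- exact: measurable_funeM.
Qed.

Lemma ge0_le_integral_comb d (T : measurableType d) (R : realType)
    (nu : {measure set T -> \bar R}) (D : set T) (f g h k : T -> \bar R) (b c e : R) :
  measurable D -> measurable_fun D f -> measurable_fun D g ->
  measurable_fun D h -> measurable_fun D k ->
  (forall x, D x -> 0 <= f x)%E -> (forall x, D x -> 0 <= g x)%E ->
  (forall x, D x -> 0 <= h x)%E -> (forall x, D x -> 0 <= k x)%E ->
  0 <= b -> 0 <= c -> 0 <= e ->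
  (forall x, D x -> f x + b%:E * g x <= c%:E * h x + e%:E * k x)%E ->
  (\int[nu]_(x in D) f x + b%:E * \int[nu]_(x in D) g x <=
   c%:E * \int[nu]_(x in D) h x + e%:E * \int[nu]_(x in D) k x)%E.
Proof.
move=> mD mf mg mh mk f0 g0 h0 k0 b0 c0 e0 fghk.
rewrite -[X in (X + _ <= _)%E]mul1e -!ge0_integral_comb//.
apply: ge0_le_integral => //.
- by move=> x Dx; rewrite adde_ge0// mule_ge0 ?lee_fin ?f0 ?g0.
- by apply: emeasurable_funD; exact: measurable_funeM.
- by apply: emeasurable_funD; exact: measurable_funeM.
by move=> x Dx; rewrite mul1e; exact: fghk.
Qed.

(** Put M = (A + B) / 2. From D >= e M, the bound S + de D <= (1 + de e / 2) M gives S <= (1 - de e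
    / 2) M. If A + B is infinite the right side is infinite as well; otherwise all four quantities
    are finite. *)
Lemma modular_contraction (R : realType) (de e eps : R) (A B S D : \bar R) :
  0 < de -> de < 1 -> 0 < e -> e <= 1 -> e <= eps ->
  (S + de%:E * D <= (1 + de * (e / 2))%:E * (2^-1%:E * (A + B)))%E ->
  (0 <= A)%E -> (0 <= B)%E -> (0 <= S)%E -> (0 <= D)%E ->
  (eps%:E * (2^-1%:E * (A + B)) <= D)%E ->
  (S <= (1 - de * (e / 2))%:E * (2^-1%:E * (A + B)))%E.
Proof.
move=> de0 de1 e0 e1 ee.
have d1 : 0 < 1 - de * (e / 2) by nra.
have h0 : 0 < (2^-1 : R) by rewrite invr_gt0.
have inf : ((1 - de * (e / 2))%:E * (2^-1%:E * +oo) = +oo)%E.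
  by rewrite !gt0_muley// lte_fin.
have [AB|ABfin] := eqVneq (A + B)%E +oo%E.
  by rewrite AB inf leey.
move: A B ABfin => [A| |] [B| |] //= _.
move: S D => [S| |] [D| |] //=; rewrite ?gt0_muley ?lte_fin// ?addey ?addye// -?EFinD -?EFinM.
move=> key A0 B0 S0 D0 hyp.
  have {}hyp : eps * (2^-1 * (A + B)) <= D by rewrite -lee_fin.
  have {}key : S + de * D <= (1 + de * (e / 2)) * (2^-1 * (A + B)) by rewrite -lee_fin.
  have {A0 B0}AB0 : 0 <= 2^-1 * (A + B).
    by rewrite mulr_ge0 ?(ltW h0)// addr_ge0// -lee_fin.
  rewrite lee_fin.
  move: (2^-1 * (A + B)) AB0 hyp key => M M0 hyp key.
  have : e * M <= D by apply: le_trans hyp; rewrite ler_wpM2r.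
  by move=> /(ler_wpM2l (ltW de0)); lra.
Qed.

Section gradient_modular.
Context {R : realType} {n : nat}.
Variables (Om : set 'rV[R]_n) (p q : 'rV[R]_n -> \bar R) (mu : 'rV[R]_n -> R).
Hypotheses (oOm : open Om) (mp : measurable_fun Om p) (mq : measurable_fun Om q).
Hypothesis mmu : measurable_fun Om mu.
Variable m : R.
Hypotheses (m1 : 1 < m)
  (pqm : {ae leb n, forall x, Om x -> admissible p q mu m x}).
Implicit Types (u v w : 'rV[R]_n -> R) (a b : R).

Local Notation H := (Hfun p q mu).
Local Notation W := (W1H Om p q mu).
Local Notation rho := (grad_modular Om p q mu).

Let mOm : measurable Om. Proof. exact: open_measurable_rV. Qed.
Let mpos : 0 < m. Proof. exact: lt_trans ltr01 m1. Qed.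
Let m0 : 0 <= m. Proof. exact: le_trans ler01 (ltW m1). Qed.

Lemma measurable_HfunE w : measurable_fun Om w ->
  measurable_fun Om (fun x => (H x `|w x|)%:E).
Proof. exact: measurable_Hfun. Qed.

Lemma measurable_enorm_wgrad u : has_weak_gradient Om u ->
  measurable_fun Om (fun x => enorm (wgrad Om u x)).
Proof.
move=> /is_weak_gradient_wgrad[_ mG _].
apply: (@measurableT_comp _ _ _ _ _ _ (@Num.sqrt R)).
  by apply: continuous_measurable_fun; exact: sqrt_continuous.
by apply: measurable_sum => i; apply: measurable_funX; have [] := mG i.
Qed.

Lemma rhoH_ge0 w : measurable_fun Om w -> (0 <= rhoH Om p q mu w)%E.
Proof.
move=> mw; have [E [mE EOm HE intE]] := ae_measurable_subset mOm pqm.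
rewrite /rhoH intE; last exact: measurable_HfunE.
by apply: integral_ge0 => x Ex; rewrite lee_fin (Hfun_ge0 _ m0)//; exact: HE.
Qed.

Lemma rhoH0 w : measurable_fun Om w -> {ae leb n, forall x, Om x -> w x = 0} ->
  rhoH Om p q mu w = 0%E.
Proof.
move=> mw w0.
have Q : {ae leb n, forall x, Om x -> admissible p q mu m x /\ w x = 0}.
  by apply: filterS2 pqm w0 => x h1 h2 Omx; split; [exact: h1|exact: h2].
have [E [mE EOm HE intE]] := ae_measurable_subset mOm Q.
rewrite /rhoH intE; last exact: measurable_HfunE.
apply: integral0_eq => x Ex; have [ax ->] := HE _ Ex.
by rewrite normr0 (@Hfun0 _ _ _ _ _ m).
Qed.

Lemma rhoH_ae_eq w w' : measurable_fun Om w -> measurable_fun Om w' ->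
  {ae leb n, forall x, Om x -> w x = w' x} -> rhoH Om p q mu w = rhoH Om p q mu w'.
Proof.
move=> mw mw' ww'; apply: ae_eq_integral => //; try exact: measurable_HfunE.
by apply: filterS ww' => x h Omx; rewrite h.
Qed.

(** The scale gives lam |a| <= l1 / 2 and lam <= l2 / 2, so |lam w3| is at most the mean of |l1 w1|
    and |l2 w2|. The summand 1 keeps the denominator positive when a = 0. It serves both for the
    functions and for the norms of their gradients. *)
Lemma rhoH_scaled_sum w1 w2 w3 (a l1 l2 lam : R) :
  measurable_fun Om w1 -> measurable_fun Om w2 -> measurable_fun Om w3 ->
  {ae leb n, forall x, Om x -> `|w3 x| <= `|a| * `|w1 x| + `|w2 x|} ->
  0 < l1 -> 0 < l2 ->
  lam = Num.min l1 l2 / (2 * (`|a| + 1)) ->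
  (rhoH Om p q mu (fun x => lam * w3 x)%R <=
   rhoH Om p q mu (fun x => l1 * w1 x)%R + rhoH Om p q mu (fun x => l2 * w2 x)%R)%E.
Proof.
move=> mw1 mw2 mw3 w123 l10 l20 lamE.
have mZ l w : measurable_fun Om w -> measurable_fun Om (fun x => l * w x).
  by move=> mw; apply: measurable_funM => //; exact: measurable_cst.
have Q : {ae leb n, forall x, Om x ->
    admissible p q mu m x /\ `|w3 x| <= `|a| * `|w1 x| + `|w2 x|}.
  by apply: filterS2 pqm w123 => x h1 h2 Omx; split; [exact: h1|exact: h2].
have [E [mE EOm HE intE]] := ae_measurable_subset mOm Q.
have mH l w : measurable_fun Om w -> measurable_fun Om (fun x => (H x `|l * w x|)%:E).
  by move=> mw; exact: measurable_HfunE (mZ l w mw).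
have mHE l w : measurable_fun Om w -> measurable_fun E (fun x => (H x `|l * w x|)%:E).
  by move=> mw; exact: measurable_funS mOm EOm (mH l w mw).
have pos w x : E x -> (0 <= (H x `|w x|)%:E)%E.
  by move=> Ex; rewrite lee_fin (Hfun_ge0 _ m0)//; have [] := HE _ Ex.
rewrite /rhoH !intE; [|exact: mH..].
have posZ l w x : E x -> (0 <= (H x `|l * w x|)%:E)%E by exact: (pos (fun x => l * w x)).
rewrite -ge0_integralD//; last 4 first.
- by move=> x; exact: posZ.
- exact: mHE.
- by move=> x; exact: posZ.
- exact: mHE.
apply: ge0_le_integral => //.
- by move=> x; exact: posZ.
- exact: mHE.
- by apply: emeasurable_funD; exact: mHE.
move=> x Ex; have [ax wx] := HE _ Ex; rewrite -EFinD lee_fin.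
apply: (@Hfun_half_le _ _ _ _ _ m) => //; first exact: ltW.
have a0 : 0 <= `|a| by [].
have min0 : 0 < Num.min l1 l2 by rewrite lt_min l10.
have ml1 : Num.min l1 l2 <= l1 by rewrite ge_min lexx.
have ml2 : Num.min l1 l2 <= l2 by rewrite ge_min lexx orbT.
have D0 : 0 < 2 * (`|a| + 1) by lra.
have lam0 : 0 < lam by rewrite lamE divr_gt0.
have {}lamE : lam * (2 * (`|a| + 1)) = Num.min l1 l2 by rewrite lamE divfK// gt_eqF.
have e1 : lam * `|a| <= 2^-1 * l1 by lra.
have e2 : lam <= 2^-1 * l2.
  have : 0 <= lam * `|a| by rewrite mulr_ge0// ltW.
  lra.
rewrite !normrM (gtr0_norm lam0) (gtr0_norm l10) (gtr0_norm l20).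
apply: le_trans (ler_wpM2l (ltW lam0) wx) _.
have := ler_wpM2r (normr_ge0 (w1 x)) e1; have := ler_wpM2r (normr_ge0 (w2 x)) e2.
lra.
Qed.

Lemma has_weak_gradient_comb a b u v : has_weak_gradient Om u ->
  has_weak_gradient Om v -> has_weak_gradient Om (a *: u + b *: v) /\
  {ae leb n, forall x, Om x ->
     wgrad Om (a *: u + b *: v) x = a *: wgrad Om u x + b *: wgrad Om v x}.
Proof.
move=> /is_weak_gradient_wgrad uG /is_weak_gradient_wgrad vG.
have bvG := is_weak_gradient_lin oOm b vG (is_weak_gradient0 Om).
have abG := is_weak_gradient_lin oOm a uG bvG.
rewrite addr0 in abG; have ex : has_weak_gradient Om (a *: u + b *: v).
  by eexists; exact: abG.
split=> //; have := is_weak_gradient_unique oOm (is_weak_gradient_wgrad ex) abG.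
by apply: filterS => x h Omx; rewrite (h Omx) addr0.
Qed.

Lemma W1H_has_weak_gradient u : W u -> has_weak_gradient Om u.
Proof. by case. Qed.

Lemma has_weak_gradient0 : has_weak_gradient Om 0 /\
  {ae leb n, forall x, Om x -> wgrad Om 0 x = 0}.
Proof.
have g0 : has_weak_gradient Om 0 by eexists; exact: is_weak_gradient0.
split=> //; exact: (is_weak_gradient_unique oOm (is_weak_gradient_wgrad g0)
  (is_weak_gradient0 Om)).
Qed.

Lemma enorm0 : enorm (0 : 'rV[R]_n) = 0.
Proof. by rewrite -(scale0r 0) enormZ normr0 mul0r. Qed.

Lemma grad_modular0 : rho 0 = 0%E.
Proof.
have [g0 g0E] := has_weak_gradient0; apply: rhoH0; first exact: measurable_enorm_wgrad.
by apply: filterS g0E => x h Omx; rewrite (h Omx) enorm0.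
Qed.

Lemma W1H_vector_subspace : vector_subspace W.
Proof.
split=> [|a u v [mu' ug [l1 l10 lu]] [mv vg [l2 l20 lv]]].
  have [g0 g0E] := has_weak_gradient0; split=> //; first exact: measurable_cst.
  exists 1 => //; rewrite (rhoH0 (w := fun x => 1 * 0 x)); last 2 first.
  - by apply: measurable_funM; exact: measurable_cst.
  - by apply: aeW => x _; rewrite mulr0.
  rewrite add0e rhoH0 ?ltry//.
  - by apply: measurable_funM (measurable_enorm_wgrad g0); exact: measurable_cst.
  - by apply: filterS g0E => x h Omx; rewrite (h Omx) enorm0 mulr0.
have [cg cgE] := has_weak_gradient_comb a 1 ug vg; rewrite scale1r in cg cgE.
have muv : measurable_fun Om (a *: u + v).
  apply: measurable_funD mv; apply: measurable_funM mu'; exact: measurable_cst.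
split=> //.
exists (Num.min l1 l2 / (2 * (`|a| + 1))).
  by rewrite divr_gt0 ?lt_min ?l10// mulr_gt0// ltr_wpDl.
have mZ l w : measurable_fun Om w -> measurable_fun Om (fun x => l * w x).
  by move=> mw; apply: measurable_funM => //; exact: measurable_cst.
have mgu := measurable_enorm_wgrad ug; have mgv := measurable_enorm_wgrad vg.
have mgc := measurable_enorm_wgrad cg.
have S1 := rhoH_scaled_sum mu' mv muv (a := a) _ l10 l20 (erefl _).
have S2 := rhoH_scaled_sum mgu mgv mgc (a := a) _ l10 l20 (erefl _).
(* Nonnegativity matters: in the extended reals [+oo + -oo] is [-oo], so a sum below [+oo] alone
   does not bound its terms. *)
have fin2 (x y : \bar R) : (0 <= x)%E -> (0 <= y)%E -> (x + y < +oo)%E ->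
    (x < +oo)%E /\ (y < +oo)%E.
  by case: x => [x| |]//; case: y => [y| |]// _ _ _; rewrite !ltry.
have [lu1 lu2] := fin2 _ _ (rhoH_ge0 (mZ l1 _ mu')) (rhoH_ge0 (mZ l1 _ mgu)) lu.
have [lv1 lv2] := fin2 _ _ (rhoH_ge0 (mZ l2 _ mv)) (rhoH_ge0 (mZ l2 _ mgv)) lv.
apply: lte_add_pinfty.
- apply: le_lt_trans (S1 _) (lte_add_pinfty lu1 lv1).
  apply: aeW => x _; apply: le_trans (ler_normD _ _) _.
  by rewrite normrM.
- apply: le_lt_trans (S2 _) (lte_add_pinfty lu2 lv2).
  apply: filterS cgE => x h Omx; rewrite (h Omx) !(ger0_norm (enorm_ge0 _)).
  by apply: le_trans (enormD _ _) _; rewrite scale1r enormZ.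
Qed.

Lemma grad_modular_ge0 u : W u -> (0 <= rho u)%E.
Proof.
by move=> /W1H_has_weak_gradient ug; apply: rhoH_ge0; exact: measurable_enorm_wgrad.
Qed.

(** A single set E serves all functions with a weak gradient, so that several modulars can be
    compared under one integral. *)
Lemma grad_modular_restrict (Q : 'rV[R]_n -> Prop) :
  {ae leb n, forall x, Om x -> Q x} ->
  exists E : set 'rV[R]_n, [/\ measurable E,
    forall x, E x -> admissible p q mu m x /\ Q x,
    forall w, has_weak_gradient Om w ->
      measurable_fun E (fun x => (H x (enorm (wgrad Om w x)))%:E) &
    forall w, has_weak_gradient Om w ->
      rho w = (\int[leb n]_(x in E) (H x (enorm (wgrad Om w x)))%:E)%E].
Proof.
move=> hQ; have {hQ} Q' : {ae leb n, forall x, Om x -> admissible p q mu m x /\ Q x}.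
  by apply: filterS2 pqm hQ => x h1 h2 Omx; split; [exact: h1|exact: h2].
have [E [mE EOm HE intE]] := ae_measurable_subset mOm Q'.
have normE w : (fun x => (H x (enorm (wgrad Om w x)))%:E) =
    (fun x => (H x `|enorm (wgrad Om w x)|)%:E).
  by apply/funext => x; rewrite (ger0_norm (enorm_ge0 _)).
have mH w : has_weak_gradient Om w ->
    measurable_fun Om (fun x => (H x (enorm (wgrad Om w x)))%:E).
  by move=> wg; rewrite normE; exact: measurable_HfunE (measurable_enorm_wgrad wg).
exists E; split; [exact: mE|exact: HE| |] => w wg.
  exact: measurable_funS mOm EOm (mH w wg).
rewrite -(intE _ (mH w wg)) normE; reflexivity.
Qed.

Lemma grad_modular_convex_semimodular : convex_semimodular W rho.
Proof.
split; [exact: grad_modular_ge0|exact: grad_modular0| |].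
  move=> a u /W1H_has_weak_gradient ug a1.
  have [cg cgE] := has_weak_gradient_comb a 0 ug ug.
  rewrite scale0r addr0 in cg cgE.
  apply: rhoH_ae_eq; try exact: measurable_enorm_wgrad.
  apply: filterS cgE => x h Omx.
  by rewrite (h Omx) scale0r addr0 enormZ a1 mul1r.
move=> a u v /W1H_has_weak_gradient ug /W1H_has_weak_gradient vg a01.
have [cg cgE] := has_weak_gradient_comb a (1 - a) ug vg.
have [E [mE HE mF intE]] := grad_modular_restrict cgE.
have pos w x : E x -> (0 <= (H x (enorm (wgrad Om w x)))%:E)%E.
  by move=> Ex; rewrite lee_fin (Hfun_ge0 _ m0)//; have [] := HE _ Ex.
have /andP[a0 a1] := a01.
have b0 : 0 <= 1 - a by rewrite subr_ge0.
rewrite (intE _ ug) (intE _ vg) (intE _ cg).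
rewrite -(ge0_integral_comb (leb n) mE (mF _ ug) (mF _ vg) (pos u) (pos v) a0 b0).
apply: ge0_le_integral; [exact: mE|exact: pos|exact: mF| |].
  by apply: emeasurable_funD; apply: measurable_funeM; exact: mF.
move=> x Ex; have [ax ->] := HE _ Ex.
rewrite -!EFinM -EFinD lee_fin.
apply: le_trans (Hfun_convex (ltW m1) ax a01 (enorm_ge0 _) (enorm_ge0 _)).
apply: (Hfun_le m0) => //; first exact: enorm_ge0.
by apply: le_trans (enormD _ _) _; rewrite !enormZ !ger0_norm.
Qed.

(* Integrating the pointwise inequality S + delta D <= (1 + delta e) A gives the
   same inequality for the modulars, whence S <= (1 - delta e) A if 2 e A <= D. *)
Lemma grad_modular_uniformly_convex : uniformly_convex W rho.
Proof.
(* Truncation at 1 keeps de * (eps / 2) below 1. The pointwise inequality is used with eps / 2, so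
   that half of the gain remains after its error term is absorbed. *)
move=> eps0 eps00; pose eps := Num.min eps0 1.
have e0 : 0 < eps by rewrite lt_min eps00 ltr01.
have e1 : eps <= 1 by rewrite ge_min lexx orbT.
have ee : eps <= eps0 by rewrite ge_min lexx.
have e2 : 0 < eps / 2 by lra.
have [de /andP[de0 de1] Hde] := @Hfun_uniform_convexity R n p q mu _ _ m1 e2.
have dee : 0 < de * (eps / 2) by rewrite mulr_gt0.
exists (de * (eps / 2)); split.
  by rewrite dee /=; apply: le_lt_trans de1; rewrite ler_piMr ?ltW//; lra.
move=> u v [Wu _] [Wv _].
have ug := W1H_has_weak_gradient Wu; have vg := W1H_has_weak_gradient Wv.
have -> : 2^-1 *: (u - v) = 2^-1 *: u + (- 2^-1) *: v.
  by rewrite scalerBr scaleNr.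
rewrite scalerDr.
have [pg pgE] := has_weak_gradient_comb 2^-1 2^-1 ug vg.
have [mg mgE] := has_weak_gradient_comb 2^-1 (- 2^-1) ug vg.
have pos w : has_weak_gradient Om w -> (0 <= rho w)%E.
  by move=> wg; apply: rhoH_ge0; exact: measurable_enorm_wgrad.
move: (pos _ ug) (pos _ vg) (pos _ pg) (pos _ mg).
have : (rho (2^-1 *: u + 2^-1 *: v)%R + de%:E * rho (2^-1 *: u + (- 2^-1) *: v)%R <=
    (1 + de * (eps / 2))%:E * (2^-1%:E * (rho u + rho v)))%E.
  have Q : {ae leb n, forall x, Om x ->
      wgrad Om (2^-1 *: u + 2^-1 *: v) x = 2^-1 *: wgrad Om u x + 2^-1 *: wgrad Om v x /\
      wgrad Om (2^-1 *: u + (- 2^-1) *: v) x =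
      2^-1 *: wgrad Om u x + (- 2^-1) *: wgrad Om v x}.
    by apply: filterS2 pgE mgE => x h1 h2 Omx; split; [exact: h1|exact: h2].
  have [E [mE HE mF intE]] := grad_modular_restrict Q.
  have posE w x : E x -> (0 <= (H x (enorm (wgrad Om w x)))%:E)%E.
    by move=> Ex; rewrite lee_fin (Hfun_ge0 _ m0)//; have [] := HE _ Ex.
  have c0 : 0 <= (1 + de * (eps / 2)) * 2^-1 by rewrite mulr_ge0// addr_ge0// ltW.
  rewrite muleA -EFinM (ge0_muleDr _ (pos _ ug) (pos _ vg)).
  rewrite (intE _ ug) (intE _ vg) (intE _ pg) (intE _ mg).
  apply: (ge0_le_integral_comb (leb n) mE (mF _ pg) (mF _ mg) (mF _ ug) (mF _ vg)
    (posE _) (posE _) (posE u) (posE v) (ltW de0) c0 c0).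
  move=> x Ex; have [ax [-> ->]] := HE _ Ex.
  have := Hde x (wgrad Om u x) (wgrad Om v x) ax.
  move: (H x _) (H x _) (H x _) (H x _) => S D A B.
  rewrite [X in _ <= X]mulrA [X in _ <= X]mulrDr => K.
  by rewrite -!EFinM -!EFinD lee_fin.
move=> key p0 m0' u0 v0 hyp.
exact: modular_contraction de0 de1 e0 e1 ee key p0 m0' u0 v0 hyp.
Qed.

End gradient_modular.

Unset Implicit Arguments.
Set Strict Implicit.
Set Printing Implicit Defensive.

Theorem theorem3p7 (R : realType) (n : nat) (Om : set 'rV[R]_n)
    (p q : 'rV[R]_n -> \bar R) (mu : 'rV[R]_n -> R)
    (n_ge2 : (2 <= n)%N)
    (Om_lip : lipschitz_domain Om)
    (p_meas : measurable_fun Om p)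
    (q_meas : measurable_fun Om q)
    (mu_meas : measurable_fun Om mu)
    (pq_range : {ae leb n, forall x, Om x ->
       (1 < p x < +oo)%E /\ (1 < q x < +oo)%E})
    (m_gt1 : (1 < Order.min (ess_inf_on Om p) (ess_inf_on Om q))%E)
    (mu_ge0 : forall x, Om x -> 0 <= mu x) :
  [/\ vector_subspace (W1H Om p q mu),
      convex_semimodular (W1H Om p q mu) (grad_modular Om p q mu) &
      uniformly_convex (W1H Om p q mu) (grad_modular Om p q mu)].
Proof.
have [_ oOm _ _] := Om_lip.
(* A finite minimum is itself the exponent m; an infinite one allows any real above 1, and 2 is
   taken. *)
have [m m1 mle] : exists2 m : R, 1 < m &
    (m%:E <= Order.min (ess_inf_on Om p) (ess_inf_on Om q))%E.
  case: (Order.min _ _) m_gt1 => [r| |]//.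
    by rewrite lte_fin => r1; exists r.
  by move=> _; exists 2; rewrite ?leey// ltr1n.
move: mle; rewrite le_min => /andP[/ess_infP mp /ess_infP mq].
(* On [Om] the patched exponents are p and q; both are finite almost everywhere, so [fine] preserves
   the lower bound m. *)
have pqm : {ae leb n, forall x, Om x -> admissible p q mu m x}.
  apply: filterS3 pq_range mp mq => x pq px qx Omx.
  have [/andP[_ ppy] /andP[_ qpy]] := pq Omx; move: px qx.
  rewrite /patch mem_set// => px qx.
  split; last exact: mu_ge0.
  - by case: (p x) px ppy => [r| |].
  - by case: (q x) qx qpy => [r| |].
split.
- exact: W1H_vector_subspace m1 pqm.
- exact: grad_modular_convex_semimodular m1 pqm.
- exact: grad_modular_uniformly_convex m1 pqm.
Qed.
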